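(* Let $P$ and $Q$ be indecomposable deformed $n$-permutahedra which are not points, and let $\lambda,\mu>0$. If $(\lambda,\mu)$ is a seed for $(P,Q)$, then the polytope $$\bigl(\mu Q+\phi(\lambda,\mu)\bigr)\boxdot\bigl(\lambda P\bigr)$$ is a ray of $\mathcal{C}(P,Q)$ (whose top and bottom faces are normally equivalent to $P$ and $Q$, respectively); that is, $\bigl(\mu Q+\phi(\lambda,\mu)\bigr)\boxdot(\lambda P)$ is indecomposable.
   Context: A deformed $n$-permutahedron is a polytope in $\mathbb{R}^n$ all of whose edges are parallel to vectors $e_i-e_j$. A polytope $P$ is indecomposable if $P=Q+R$ (Minkowski sum) implies that $Q$ and $R$ are translated dilates of $P$. Two polytopes are normally equivalent if they have the same normal fan. $Q\trianglelefteq P$ ($Q$ is a deformation of $P$) means $Q+R=\lambda P$ for some $\lambda>0$ and some polytope $R$. For $\sigma\in\mathcal{S}_n$ let $C_\sigma=\{c\in\mathbb{R}^n : c_{\sigma(1)}\le\dots\le c_{\sigma(n)}\}$; for a deformed $n$-permutahedron $P$, $P^\sigma$ is the vertex of $P$ maximizing $\langle\cdot,c\rangle$ for any $c$ in the interior of $C_\sigma$, and $P^\sigma_i$ its $i$-th coordinate. $Q\preceq P$ means $Q^\sigma_i\le P^\sigma_i$ for all $\sigma\in\mathcal{S}_n$, $i\in[n]$. The GP-sum is $Q\boxdot P=(Q+\mathbb{R}^n_+)\cap(P+\mathbb{R}^n_-)$. The top (resp. bottom) face of a polytope $R\subset \mathbb{R}^n$ is its face maximizing (resp. minimizing) $\sum_{i=1}^n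 x_i$. The admissibility cone is $\mathcal{C}(P,Q)=\{Q'\boxdot P' : P'\trianglelefteq P,\ Q'\trianglelefteq Q,\ Q'\preceq P'\}$; it is a polyhedral cone (under Minkowski sum and dilation) with an $n$-dimensional lineality space given by translations, and an element is called a ray if it spans a one-dimensional face modulo this lineality space. For the fixed pair $(P,Q)$, $\phi:\mathbb{R}^2\to\mathbb{R}^n$ is defined by $\phi(\lambda,\mu)_i=\min_{\sigma\in\mathcal{S}_n}(\lambda P^\sigma_i-\mu Q^\sigma_i)$. A couple $(\lambda,\mu)$ with $\lambda,\mu>0$ is a seed for $(P,Q)$ if there exist $j\in[n]$ and two permutations $\tau,\tau'$ in the set of minimizers of $\sigma\mapsto\lambda P^\sigma_j-\mu Q^\sigma_j$ over $\mathcal{S}_n$ with $(P^\tau_j,Q^\tau_j)\neq(P^{\tau'}_j,Q^{\tau'}_j)$. *)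

(* Defs.v *)
From HB Require Import structures.
From mathcomp Require Import all_boot all_order all_algebra all_fingroup.
From mathcomp Require Import all_classical all_reals all_analysis.

Set Implicit Arguments.
Unset Strict Implicit.
Unset Printing Implicit Defensive.

Import Order.TTheory GRing.Theory Num.Theory.
Import numFieldNormedType.Exports.

Local Open Scope classical_set_scope.
Local Open Scope ring_scope.

Definition msum (R : realType) (n : nat) (A B : set 'rV[R]_n) : set 'rV[R]_n :=
  [set x + y | x in A & y in B].

Definition dilate (R : realType) (n : nat) (a : R) (A : set 'rV[R]_n) :
    set 'rV[R]_n :=
  [set a *: x | x in A].

Definition conv_hull (R : realType) (n k : nat) (v : 'I_k -> 'rV[R]_n) :
    set 'rV[R]_n :=
  [set x | exists a : 'I_k -> R,
     [/\ forall i, 0 <= a i, \sum_i a i = 1 & x = \sum_i a i *: v i]].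

(* Polytopes are nonempty. *)
Definition polytope (R : realType) (n : nat) (P : set 'rV[R]_n) : Prop :=
  exists (k : nat) (v : 'I_k.+1 -> 'rV[R]_n), P = conv_hull v.

Definition is_point (R : realType) (n : nat) (P : set 'rV[R]_n) : Prop :=
  exists x, P = [set x].

Definition dotp (R : realType) (n : nat) (x c : 'rV[R]_n) : R :=
  \sum_i x 0 i * c 0 i.

Definition face (R : realType) (n : nat) (P : set 'rV[R]_n) (c : 'rV[R]_n) :
    set 'rV[R]_n :=
  [set x | P x /\ forall y, P y -> dotp y c <= dotp x c].

Definition top_face (R : realType) (n : nat) (P : set 'rV[R]_n) :
    set 'rV[R]_n :=
  [set x | P x /\ forall y, P y -> \sum_i y 0 i <= \sum_i x 0 i].

Definition bottom_face (R : realType) (n : nat) (P : set 'rV[R]_n) :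
    set 'rV[R]_n :=
  [set x | P x /\ forall y, P y -> \sum_i x 0 i <= \sum_i y 0 i].

Definition segment (R : realType) (n : nat) (a b : 'rV[R]_n) : set 'rV[R]_n :=
  [set a + t *: (b - a) | t in [set t : R | 0 <= t <= 1]].

Definition deformed_permutahedron (R : realType) (n : nat)
    (P : set 'rV[R]_n) : Prop :=
  polytope P /\
  forall c a b : 'rV[R]_n, a != b -> face P c = segment a b ->
    exists (i j : 'I_n) (t : R), b - a = t *: (delta_mx 0 i - delta_mx 0 j).

(* Dilation factors may vanish: a point is a translated dilate of every
   polytope. *)
Definition translated_dilate (R : realType) (n : nat)
    (Q P : set 'rV[R]_n) : Prop :=
  exists (a : R) (t : 'rV[R]_n), 0 <= a /\ Q = msum (dilate a P) [set t].

Definition indecomposable (R : realType) (n : nat) (P : set 'rV[R]_n) : Prop :=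
  polytope P /\
  forall Q S : set 'rV[R]_n, polytope Q -> polytope S -> P = msum Q S ->
    translated_dilate Q P /\ translated_dilate S P.

(* The normal cone of the face F of P is [set c | F `<=` face P c]. *)
Definition normal_fan (R : realType) (n : nat) (P : set 'rV[R]_n) :
    set (set 'rV[R]_n) :=
  [set [set c | face P c0 `<=` face P c] | c0 in [set: 'rV[R]_n]].

Definition normally_equivalent (R : realType) (n : nat)
    (P Q : set 'rV[R]_n) : Prop :=
  normal_fan P = normal_fan Q.

Definition deformation (R : realType) (n : nat) (Q P : set 'rV[R]_n) : Prop :=
  polytope Q /\
  exists (a : R) (S : set 'rV[R]_n),
    [/\ 0 < a, polytope S & msum Q S = dilate a P].

Definition braid_cone (R : realType) (n : nat) (s : 'S_n) : set 'rV[R]_n :=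
  [set c | forall i j : 'I_n, (i <= j)%N -> c 0 (s i) <= c 0 (s j)].

(* The default value 0 is never used when P is a deformed permutahedron. *)
Definition perm_vertex (R : realType) (n : nat) (P : set 'rV[R]_n) (s : 'S_n) :
    'rV[R]_n :=
  xget 0 [set v | forall c, interior (@braid_cone R n s) c ->
                    face P c = [set v]].

Definition dominated (R : realType) (n : nat) (Q P : set 'rV[R]_n) : Prop :=
  forall (s : 'S_n) (i : 'I_n), perm_vertex Q s 0 i <= perm_vertex P s 0 i.

Definition nneg_orthant (R : realType) (n : nat) : set 'rV[R]_n :=
  [set x | forall i, 0 <= x 0 i].

Definition npos_orthant (R : realType) (n : nat) : set 'rV[R]_n :=
  [set x | forall i, x 0 i <= 0].

Definition gp_sum (R : realType) (n : nat) (Q P : set 'rV[R]_n) :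
    set 'rV[R]_n :=
  msum Q (@nneg_orthant R n) `&` msum P (@npos_orthant R n).

Definition admissibility_cone (R : realType) (n : nat) (P Q : set 'rV[R]_n) :
    set (set 'rV[R]_n) :=
  [set X | exists P' Q' : set 'rV[R]_n,
     [/\ deformation P' P, deformation Q' Q, dominated Q' P'
       & X = gp_sum Q' P']].

(* F is the intersection of the cone C of polytopes with a supporting
   hyperplane.  A linear functional on the vector space of virtual polytopes
   spanned by C is the same as a function on C that is additive for the
   Minkowski sum and homogeneous for dilations. *)
Definition cone_face (R : realType) (n : nat) (C F : set (set 'rV[R]_n)) :
    Prop :=
  exists l : set 'rV[R]_n -> R,
    [/\ forall A B, C A -> C B -> l (msum A B) = l A + l B,
        forall a A, 0 <= a -> C A -> l (dilate a A) = a * l A,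
        forall A, C A -> 0 <= l A
      & F = [set A | C A /\ l A = 0]].

(* Rays modulo a lineality space consisting of the translations, that is, of
   the points: X is nonzero modulo translations, and the half-line it generates
   modulo translations is a face. *)
Definition cone_ray (R : realType) (n : nat) (C : set (set 'rV[R]_n))
    (X : set 'rV[R]_n) : Prop :=
  [/\ C X, ~ is_point X & cone_face C [set A | translated_dilate A X]].

Definition phi_diff (R : realType) (n : nat) (P Q : set 'rV[R]_n)
    (lam mu : R) (i : 'I_n) (s : 'S_n) : R :=
  lam * perm_vertex P s 0 i - mu * perm_vertex Q s 0 i.

(* The minimum over all of 'S_n; the initial value of the iterated minimum is
   one of the terms. *)
Definition phi (R : realType) (n : nat) (P Q : set 'rV[R]_n) (lam mu : R) :
    'rV[R]_n :=
  \row_i \big[Num.min/phi_diff P Q lam mu i 1%g]_(s : 'S_n)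
           phi_diff P Q lam mu i s.

Definition phi_minimizer (R : realType) (n : nat) (P Q : set 'rV[R]_n)
    (lam mu : R) (j : 'I_n) (t : 'S_n) : Prop :=
  forall s : 'S_n, phi_diff P Q lam mu j t <= phi_diff P Q lam mu j s.

Definition seed (R : realType) (n : nat) (P Q : set 'rV[R]_n) (lam mu : R) :
    Prop :=
  [/\ 0 < lam, 0 < mu &
    exists (j : 'I_n) (t t' : 'S_n),
      [/\ phi_minimizer P Q lam mu j t, phi_minimizer P Q lam mu j t' &
          (perm_vertex P t 0 j, perm_vertex Q t 0 j) <>
          (perm_vertex P t' 0 j, perm_vertex Q t' 0 j)]].

Definition seed_polytope (R : realType) (n : nat) (P Q : set 'rV[R]_n)
    (lam mu : R) : set 'rV[R]_n :=
  gp_sum (msum (dilate mu Q) [set phi P Q lam mu]) (dilate lam P).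

(* Main.v *)
Require Import Defs.
From mathcomp Require Import all_boot all_order all_algebra all_fingroup.
From mathcomp Require Import all_classical all_reals all_analysis.
From mathcomp Require Import ring lra.

(** Write [P^s] for the vertex of [P] at the permutation [s].

    A polytope [gp_sum Q' P'] with [Q'] dominated by [P'] is known through its
    support function: for [c] in the braid cone of [s] its value at [c] is
    [<P'^s, c+> + <Q'^s, c->], where [c+] and [c-] are the positive and negative
    parts of [c] ([gp_sum_hull]).  In particular its top face is [P'] and its
    bottom face is [Q'] ([gp_sum_top], [gp_sum_bottom]), so that an element [X] of
    the admissibility cone is the same as a pair of deformations of [P] and [Q],
    its top and bottom faces, subject to the inequalities [slack X s i >= 0],
    where the slack is the [i]-th coordinate of the difference of the vertices at
    [s] of the two faces.  Slacks are linear in [X].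

    As [P] and [Q] are indecomposable, the faces of an admissible polytope are
    [a P + x] and [b Q + y], and its slacks depend only on [a], [b] and [y - x].
    The sum [tight_slack] of all slacks that vanish at the seed polytope is a
    nonnegative linear functional on the cone.  If it vanishes at some [A], all
    these slacks of [A] vanish.  The two of them provided by the seed are
    different linear equations in [a], [b] and one coordinate of [y - x]; they
    force [(a, b)] to be proportional to [(lam, mu)], and one slack for each
    coordinate then gives [y - x] ([tight_translated_dilate]).  Hence the zero
    set of the functional is the set of translated dilates of the seed polytope,
    which is therefore a ray.

    Indecomposability follows because a Minkowski summand of an admissible
    polytope is admissible ([admissible_summand]): the two summands have
    nonnegative values adding up to [0].  A summand is recovered from its own
    top and bottom faces by a comparison of support functions.

    All this rests on two facts on polytopes: a point outside a polytope can be
    strictly separated from it ([hull_separation]), and a face with two vertices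
    contains an edge ([exists_edge]); the latter turns the condition on edge
    directions into the existence of the vertices [P^s]
    ([deformed_braid_vertex]). *)

Set Implicit Arguments.
Unset Strict Implicit.
Unset Printing Implicit Defensive.

Import Order.TTheory GRing.Theory Num.Theory.
Import numFieldNormedType.Exports.
Import Defs.
Local Open Scope classical_set_scope.
Local Open Scope ring_scope.

(** * The pairing *)

Section DotProduct.
Variables (R : realType) (n : nat).
Implicit Types x y c d : 'rV[R]_n.

Lemma dotpC x c : dotp x c = dotp c x.
Proof. by apply: eq_bigr => i _; rewrite mulrC. Qed.

Lemma dotpDl x y c : dotp (x + y) c = dotp x c + dotp y c.
Proof. by rewrite -big_split; apply: eq_bigr => i _; rewrite mxE mulrDl. Qed.

Lemma dotpZl a x c : dotp (a *: x) c = a * dotp x c.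
Proof. by rewrite mulr_sumr; apply: eq_bigr => i _; rewrite mxE mulrA. Qed.

Lemma dotpNl x c : dotp (- x) c = - dotp x c.
Proof. by rewrite -scaleN1r dotpZl mulN1r. Qed.

Lemma dotpBl x y c : dotp (x - y) c = dotp x c - dotp y c.
Proof. by rewrite dotpDl dotpNl. Qed.

Lemma dotpDr x c d : dotp x (c + d) = dotp x c + dotp x d.
Proof. by rewrite ![dotp x _]dotpC dotpDl. Qed.

Lemma dotpZr a x c : dotp x (a *: c) = a * dotp x c.
Proof. by rewrite ![dotp x _]dotpC dotpZl. Qed.

Lemma dotpNr x c : dotp x (- c) = - dotp x c.
Proof. by rewrite ![dotp x _]dotpC dotpNl. Qed.

Lemma dotpBr x c d : dotp x (c - d) = dotp x c - dotp x d.
Proof. by rewrite dotpDr dotpNr. Qed.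

Lemma dotp0l c : dotp 0 c = 0.
Proof. by rewrite -(scale0r 0) dotpZl mul0r. Qed.

Lemma dotp_suml (I : finType) (F : I -> 'rV[R]_n) c :
  dotp (\sum_i F i) c = \sum_i dotp (F i) c.
Proof.
apply: (big_morph (fun x => dotp x c)) => [x y|]; [exact: dotpDl|exact: dotp0l].
Qed.

Lemma dotp_delta x i : dotp x (delta_mx 0 i) = x 0 i.
Proof.
rewrite /dotp (bigD1 i) //= mxE !eqxx mulr1 big1 ?addr0 // => j ji.
by rewrite mxE (negPf ji) andbF mulr0.
Qed.

Lemma dotpp_ge0 x : 0 <= dotp x x.
Proof. by apply: sumr_ge0 => i _; rewrite -expr2 sqr_ge0. Qed.

Lemma dotpp_eq0 x : dotp x x = 0 -> x = 0.
Proof.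
move=> /eqP; rewrite psumr_eq0 => [/allP x0|i _]; last by rewrite -expr2 sqr_ge0.
apply/rowP => i; rewrite mxE; apply/eqP.
by have := x0 i (mem_index_enum _); rewrite -expr2 sqrf_eq0.
Qed.

Lemma dotpp_gt0 x : x != 0 -> 0 < dotp x x.
Proof.
by move=> x0; rewrite lt_def dotpp_ge0 andbT; apply: contra x0 => /eqP/dotpp_eq0->.
Qed.

End DotProduct.

(** * Convex hulls and separation *)

Section Hull.
Variables (R : realType) (n : nat).
Implicit Types (x y c d : 'rV[R]_n) (A B G : set 'rV[R]_n).

(** The convex hull of a family indexed by an arbitrary finite type, so that
    products and permutations can index generators; for the index type ['I_k]
    it is [conv_hull] by definition. *)
Definition hull (I : finType) (v : I -> 'rV[R]_n) : set 'rV[R]_n :=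
  [set x | exists a : I -> R,
     [/\ forall i, 0 <= a i, \sum_i a i = 1 & x = \sum_i a i *: v i]].

Lemma hull_polytope (I : finType) (i0 : I) (v : I -> 'rV[R]_n) :
  polytope (hull v).
Proof.
have eI : #|I| = #|I|.-1.+1 by rewrite prednK //; apply/card_gt0P; exists i0.
pose f i := enum_val (cast_ord (esym eI) i).
pose g i := cast_ord eI (enum_rank i).
have fK : cancel g f by move=> i; rewrite /f /g cast_ordK enum_rankK.
have gK : cancel f g by move=> i; rewrite /f /g enum_valK cast_ordKV.
exists #|I|.-1, (v \o f); apply/seteqP; split => x [a [a0 a1 ->]].
- exists (a \o f); split => [i||] /=; first exact: a0.
  + by rewrite -a1 [RHS](reindex f) //; exists g => ? _.
  + by rewrite [LHS](reindex f) //; exists g => ? _.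
- exists (a \o g); split => [i||] /=; first exact: a0.
  + by rewrite -a1 [RHS](reindex g) //; exists f => ? _.
  + rewrite [LHS](reindex g) //=; last by exists f => ? _.
    by apply: eq_bigr => i _; rewrite fK.
Qed.

Lemma hull_gen (I : finType) (v : I -> 'rV[R]_n) i : hull v (v i).
Proof.
exists (fun j => (j == i)%:R); split => [j||]; first exact: ler0n.
- by rewrite (bigD1 i) //= eqxx big1 ?addr0 // => j /negPf->.
- rewrite (bigD1 i) //= eqxx scale1r big1 ?addr0 // => j /negPf->.
  by rewrite scale0r.
Qed.

Lemma hull_le (I : finType) (v : I -> 'rV[R]_n) c M x :
  (forall i, dotp (v i) c <= M) -> hull v x -> dotp x c <= M.
Proof.
move=> vM [a [a0 a1 ->]]; rewrite dotp_suml -[M]mul1r -a1 mulr_suml.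
by apply: ler_sum => i _; rewrite dotpZl ler_wpM2l.
Qed.

Lemma hull_toward (I : finType) (v : I -> 'rV[R]_n) x i t :
  0 <= t <= 1 -> hull v x -> hull v (x + t *: (v i - x)).
Proof.
move=> /andP[t0 t1] [a [a0 a1 xE]]; have [b [b0 b1 vE]] := hull_gen v i.
exists (fun j => (1 - t) * a j + t * b j); split => [j||].
- by rewrite addr_ge0 // mulr_ge0 // subr_ge0.
- by rewrite big_split /= -!mulr_sumr a1 b1 !mulr1 subrK.
- under eq_bigr do rewrite scalerDl -!scalerA.
  rewrite big_split /= -!scaler_sumr -xE -vE.
  by apply/rowP => j; rewrite !mxE; ring.
Qed.

Lemma continuous_sum (T : topologicalType) (I : finType) (F : I -> T -> R) :
  (forall i, continuous (F i)) -> continuous (fun z => \sum_i F i z).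
Proof.
move=> Fc; apply: (@continuous_big R I +%R 0 xpredT) => [|i _]; last exact: Fc.
exact: add_continuous.
Qed.

(** The hull is the image of a compact simplex of weights, on which the squared
    distance is continuous. *)
Lemma hull_closest k (v : 'I_k.+1 -> 'rV[R]_n) x :
  exists2 p, hull v p &
    forall y, hull v y -> dotp (x - p) (x - p) <= dotp (x - y) (x - y).
Proof.
pose pt (a : 'rV[R]_k.+1) := \sum_i a 0 i *: v i.
pose f a := dotp (x - pt a) (x - pt a).
pose S := [set a : 'rV[R]_k.+1 | forall i, `[0, 1]%classic (a 0 i)] `&`
          [set a | \sum_i a 0 i = 1].
have hS a : S a -> hull v (pt a).
  move=> [a01 a1]; exists (fun i => a 0 i); split=> // i.
  by have := a01 i; rewrite /= in_itv /= => /andP[].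
have Sh y : hull v y -> exists2 a, S a & y = pt a.
  move=> [a [a0 a1 ->]]; exists (\row_i a i); last first.
    by apply: eq_bigr => i _; rewrite mxE.
  split=> /= [i|]; last by rewrite -a1; apply: eq_bigr => i _; rewrite mxE.
  by rewrite mxE in_itv /= a0 -a1 (bigD1 i) //= lerDl sumr_ge0.
have cS : compact S.
  apply: compact_closedI; first by apply: (@rV_compact R _ (fun=> `[0, 1]%classic)) => i; exact: segment_compact.
  apply: (@preimage_closed _ _ (fun a : 'rV[R]_k.+1 => \sum_i a 0 i)
            [set y | y = 1]); last exact: closed_eq.
  have sc : continuous (fun a : 'rV[R]_k.+1 => \sum_i a 0 i).
    by apply: continuous_sum => i; exact: coord_continuous.
  by move=> a _; exact: sc.
have fc : continuous f.
  rewrite /f /dotp; apply: continuous_sum => j.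
  have cj : continuous (fun a => (x - pt a) 0 j).
    have -> : (fun a => (x - pt a) 0 j) =
              (fun a : 'rV_k.+1 => x 0 j - \sum_i a 0 i * v i 0 j).
      apply/funext => a; rewrite !mxE summxE; congr (_ - _).
      by apply: eq_bigr => i _; rewrite mxE.
    have sc : continuous (fun a : 'rV[R]_k.+1 => \sum_i a 0 i * v i 0 j).
      apply: continuous_sum => i a.
      by apply: continuousM; [exact: coord_continuous|exact: cst_continuous].
    by move=> a; apply: continuousB; [exact: cst_continuous|exact: sc].
  by move=> a; apply: continuousM; exact: cj.
have [] := @EVT_min_rV R _ f S _ cS _.
- by have [a Sa _] := Sh _ (hull_gen v ord0); exists a.
- exact: continuous_subspaceT.
move=> a /set_mem Sa am; exists (pt a); first exact: hS.
by move=> y /Sh[b Sb ->]; apply: am; exact: mem_set.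
Qed.

(** The outer normal of the hull at the point [p] closest to [x] is [x - p]: if
    a generator were strictly further in that direction than [p], moving [p]
    slightly towards it would decrease the distance to [x]. *)
Lemma hull_separation k (v : 'I_k.+1 -> 'rV[R]_n) x :
  ~ hull v x -> exists c, forall i, dotp (v i) c < dotp x c.
Proof.
move=> nx; have [p hp pmin] := hull_closest v x.
have xp : x - p != 0 by apply/eqP => /subr0_eq xp; apply: nx; rewrite xp.
exists (x - p) => i; have c0 := dotpp_gt0 xp.
set c := x - p in pmin c0 *.
suff : dotp (v i - p) c <= 0.
  by rewrite dotpBl => h; rewrite /c dotpBl -/c in c0; lra.
rewrite leNgt; apply/negP => d0; set d := v i - p in d0.
have ineq t : 0 <= t <= 1 -> 2 * t * dotp d c <= t ^+ 2 * dotp d d.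
  move=> t01; have := pmin _ (hull_toward i t01 hp); rewrite -/d.
  have -> : x - (p + t *: d) = c - t *: d by rewrite opprD addrA.
  clearbody c d; rewrite !(dotpBl, dotpBr, dotpZl, dotpZr) (dotpC c d); lra.
have dd0 := dotpp_ge0 d; have := ineq 1; rewrite ler01 lexx => /(_ isT) h1.
have ddc : dotp d c < dotp d d by lra.
have ddp : 0 < dotp d d by lra.
(* The minimum of the squared distance along the line from [p] to [v i]. *)
have := ineq (dotp d c / dotp d d).
rewrite divr_ge0 ?(ltW d0) // ler_pdivrMr // mul1r (ltW ddc) => /(_ isT).
have -> : (dotp d c / dotp d d) ^+ 2 * dotp d d = dotp d c / dotp d d * dotp d c.
  by field; rewrite gt_eqF.
have : 0 < dotp d c / dotp d d * dotp d c by rewrite !mulr_gt0 ?invr_gt0.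
lra.
Qed.

Lemma arg_maxR (I : finType) (i0 : I) (f : I -> R) :
  exists i, forall j, f j <= f i.
Proof.
exists [arg max_(i > i0) f i]%O; case: arg_maxP => // i _ im j; exact: im.
Qed.

Lemma hull_max (I : finType) (i0 : I) (v : I -> 'rV[R]_n) c :
  exists i, face (hull v) c (v i).
Proof.
have [i im] := arg_maxR i0 (fun i => dotp (v i) c).
by exists i; split; [exact: hull_gen|move=> y; exact: hull_le].
Qed.

Lemma polytope_max A c : polytope A -> exists a, face A c a.
Proof. by move=> [k [v ->]]; have [i] := hull_max ord0 v c; exists (v i). Qed.

(** Separation as a comparison principle: inclusion into a polytope can be
    tested on support functions. *)
Lemma sub_polytope A G : polytope A ->
  (forall c, exists2 a, A a & forall y, G y -> dotp y c <= dotp a c) ->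
  G `<=` A.
Proof.
move=> [k [v ->]] h x Gx; apply: contrapT => /hull_separation[c vc].
have [a ha /(_ x Gx)] := h c; apply/negP; rewrite -ltNge.
have [i im] := arg_maxR ord0 (fun i => dotp (v i) c).
exact: le_lt_trans (hull_le im ha) (vc i).
Qed.

Lemma polytope_hull_sub A (I : finType) (w : I -> 'rV[R]_n) :
  polytope A -> (forall i, A (w i)) -> hull w `<=` A.
Proof.
move=> pA Aw; apply: (sub_polytope pA) => c.
have [a [Aa am]] := polytope_max c pA; exists a => // y; apply: hull_le => i.
exact: am.
Qed.

(** Generators outside the face are replaced by one inside it, which keeps the
    index type. *)
Lemma face_hull (I : finType) (v : I -> 'rV[R]_n) c i0 :
  face (hull v) c (v i0) ->
  face (hull v) c =
  hull (fun i => if dotp (v i) c == dotp (v i0) c then v i else v i0).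
Proof.
set w := fun i => _; move=> [_ im]; apply/seteqP; split => x.
- move=> [hx xm]; have xc : dotp x c = dotp (v i0) c.
    by apply/eqP; rewrite eq_le im // xm //; exact: hull_gen.
  move: (hx) => -[a [a0 a1 xE]]; exists a; split => //.
  rewrite xE; apply: eq_bigr => i _; rewrite /w; case: eqP => // /eqP ni.
  suff -> : a i = 0 by rewrite !scale0r.
  have /eqP : \sum_i a i * (dotp (v i0) c - dotp (v i) c) = 0.
    under eq_bigr do rewrite mulrBr.
    rewrite sumrB -mulr_suml a1 mul1r -xc {1}xE dotp_suml.
    by under eq_bigr do rewrite dotpZl; rewrite subrr.
  rewrite psumr_eq0 => [/allP/(_ i (mem_index_enum _))|j _]; last first.
    by rewrite mulr_ge0 // subr_ge0 im //; exact: hull_gen.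
  by rewrite mulf_eq0 subr_eq0 [dotp _ _ == _]eq_sym (negPf ni) orbF => /eqP.
- move=> hx; split.
    apply: polytope_hull_sub hx => [|i]; first exact: hull_polytope.
    by rewrite /w; case: ifP => _; exact: hull_gen.
  move=> y Ay; apply: le_trans (im y Ay) _.
  move: hx => [a [a0 a1 ->]]; rewrite dotp_suml.
  have wc i : dotp (w i) c = dotp (v i0) c by rewrite /w; case: eqP.
  under eq_bigr do rewrite dotpZl wc.
  by rewrite -mulr_suml a1 mul1r.
Qed.

Lemma face_polytope A c : polytope A -> polytope (face A c).
Proof.
move=> [k [v ->]]; have [i0 hi] := hull_max ord0 v c.
by rewrite (face_hull hi); exact: (hull_polytope ord0).
Qed.

Lemma point_polytope x : polytope [set x].
Proof.
exists 0, (fun=> x); apply/seteqP; split => y.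
- by move=> ->; exact: (@hull_gen _ (fun=> x) ord0).
- move=> [a [_ a1 ->]]; rewrite /= -scaler_suml a1 scale1r //.
Qed.

Lemma dilate_polytope a A : polytope A -> polytope (dilate a A).
Proof.
move=> [k [v ->]]; exists k, (fun i => a *: v i); apply/seteqP; split => y.
- move=> [x [b [b0 b1 ->]] <-]; exists b; split => //.
  by rewrite scaler_sumr; apply: eq_bigr => i _; rewrite !scalerA mulrC.
- move=> [b [b0 b1 ->]]; exists (\sum_i b i *: v i); first by exists b.
  by rewrite scaler_sumr; apply: eq_bigr => i _; rewrite !scalerA mulrC.
Qed.

Lemma msum_polytope A B : polytope A -> polytope B -> polytope (msum A B).
Proof.
move=> pA pB; have [k [v AE]] := pA; have [l [w BE]] := pB.
pose u (ij : 'I_k.+1 * 'I_l.+1) := v ij.1 + w ij.2.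
suff -> : msum A B = hull u by exact: (hull_polytope (ord0, ord0)).
apply/seteqP; split => x.
- apply: sub_polytope (hull_polytope (ord0, ord0) u) _ _ => c.
  have [i [_ im]] := hull_max ord0 v c; have [j [_ jm]] := hull_max ord0 w c.
  exists (u (i, j)); first exact: hull_gen.
  move=> _ [a Aa] [b Bb] <-; rewrite !dotpDl lerD //.
    by apply: im; rewrite -[hull v]/(conv_hull v) -AE.
  by apply: jm; rewrite -[hull w]/(conv_hull w) -BE.
- move=> [a [a0 a1 ->]].
  have sumE (V : nmodType) (F : 'I_k.+1 * 'I_l.+1 -> V) :
      \sum_p F p = \sum_i \sum_j F (i, j).
    by rewrite pair_bigA; apply: eq_bigr => -[].
  rewrite sumE in a1.
  exists (\sum_i (\sum_j a (i, j)) *: v i).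
    by rewrite AE; exists (fun i => \sum_j a (i, j)); split => // i; exact: sumr_ge0.
  exists (\sum_j (\sum_i a (i, j)) *: w j).
    rewrite BE; exists (fun j => \sum_i a (i, j)); split => // [j|].
      exact: sumr_ge0.
    by rewrite exchange_big.
  rewrite sumE /u /=.
  under [in RHS]eq_bigr do under eq_bigr do rewrite scalerDr.
  under [in RHS]eq_bigr do rewrite big_split.
  rewrite big_split; congr (_ + _).
    by apply: eq_bigr => i _; rewrite scaler_suml.
  by rewrite exchange_big; apply: eq_bigr => i _; rewrite scaler_suml.
Qed.

End Hull.

(** * Finite families of affine functions *)

Section Scalar.
Variable R : realType.

Lemma uniform_lower_bound (I : finType) (f : I -> R) :
  (forall i, 0 < f i) -> exists2 e, 0 < e & forall i, e <= f i.
Proof.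
move=> f0; exists (\big[Num.min/1]_i f i); last by move=> i; exact: bigmin_le.
by rewrite lt_bigmin // ltr01 /=; apply/forallP => i; rewrite f0.
Qed.

Lemma small_perturbation (I : finType) (f g : I -> R) :
  exists2 e, 0 < e & forall i, 0 < f i -> 0 < f i + e * g i.
Proof.
have d0 i : 0 < 1 + `|g i| by rewrite ltr_pwDl.
have [|e e0 he] := @uniform_lower_bound I
    (fun i => if 0 < f i then f i / (1 + `|g i|) else 1).
  by move=> i; case: ifP => // fi; rewrite divr_gt0.
exists e => // i fi; have := he i; rewrite fi ler_pdivlMr // => h.
have : e * - g i <= e * `|g i| by rewrite ler_wpM2l ?(ltW e0) // -normrN ler_norm.
lra.
Qed.

(** Increasing [t] from [0], this is the first time at which one of the functions
    [t |-> f i + t * g i], all nonpositive at [0], is about to become positive. *)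
Lemma first_crossing (I : finType) (S : pred I) (f g : I -> R) (i1 : I) :
  (forall i, S i -> f i <= 0) -> S i1 -> 0 < g i1 ->
  exists t i, [/\ 0 <= t, S i, 0 < g i, f i + t * g i = 0 &
                  forall j, S j -> f j + t * g j <= 0].
Proof.
move=> f0 Si gi.
have [|i /andP[Sm gm] im] := @arg_minP _ R I i1
    (fun i => S i && (0 < g i)) (fun i => - f i / g i); first by rewrite Si.
exists (- f i / g i), i; split => //.
- by rewrite divr_ge0 ?oppr_ge0 ?f0 // ltW.
- by field; rewrite gt_eqF.
- move=> j Sj; have [gj|gj] := ltP 0 (g j).
    have := im j; rewrite Sj gj => /(_ isT); rewrite ler_pdivlMr //; lra.
  have : - f i / g i * g j <= 0.
    by rewrite mulr_ge0_le0 // divr_ge0 ?oppr_ge0 ?f0 // ltW.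
  have := f0 j Sj; lra.
Qed.

End Scalar.

(** * Edges of polytopes *)

Section Edges.
Variables (R : realType) (n : nat).
Implicit Types (x y c d : 'rV[R]_n).

Section MaximalGenerators.
Variables (k : nat) (v : 'I_k.+1 -> 'rV[R]_n).

Definition max_gens c : {set 'I_k.+1} :=
  [set i | [forall j, dotp (v j) c <= dotp (v i) c]].

Lemma max_gensP c i :
  reflect (forall j, dotp (v j) c <= dotp (v i) c) (i \in max_gens c).
Proof. by rewrite inE; exact: forallP. Qed.

Lemma max_gens_neq0 c : exists i, i \in max_gens c.
Proof.
have [i im] := arg_maxR ord0 (fun i => dotp (v i) c).
by exists i; apply/max_gensP.
Qed.

Lemma max_gens_eq c i j :
  i \in max_gens c -> j \in max_gens c -> dotp (v i) c = dotp (v j) c.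
Proof. by move=> /max_gensP hi /max_gensP hj; apply/eqP; rewrite eq_le hi hj. Qed.

Lemma max_gens_face c i : i \in max_gens c -> face (hull v) c (v i).
Proof.
by move=> /max_gensP im; split; [exact: hull_gen|move=> y; exact: hull_le].
Qed.

(** A face of a face is a face. *)
Lemma max_gens_perturb c d : exists c', forall i,
  i \in max_gens c' <->
  i \in max_gens c /\
  forall j, j \in max_gens c -> dotp (v j) d <= dotp (v i) d.
Proof.
have [e e0 he] := small_perturbation
  (fun ij : 'I_k.+1 * 'I_k.+1 => dotp (v ij.1 - v ij.2) c)
  (fun ij => dotp (v ij.1 - v ij.2) d).
have {}he i j : dotp (v j) c < dotp (v i) c ->
    dotp (v j) (c + e *: d) < dotp (v i) (c + e *: d).
  have := he (i, j); rewrite /= !dotpBl subr_gt0 => /[apply].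
  by rewrite !dotpDr !dotpZr; lra.
exists (c + e *: d) => i; split => [hi|[hi him]].
- have ci : i \in max_gens c.
    have [m /max_gensP hm] := max_gens_neq0 c; apply/max_gensP => j.
    apply: le_trans (hm j) _; rewrite leNgt; apply/negP => /he.
    by apply/negP; rewrite -leNgt; move/max_gensP: hi; exact.
  split=> // j cj; move/max_gensP: hi => /(_ j).
  by rewrite !dotpDr !dotpZr (max_gens_eq cj ci) lerD2l ler_pM2l.
- apply/max_gensP => j; have /max_gensP/(_ j) := hi.
  rewrite le_eqVlt => /orP[/eqP ji|/he/ltW//].
  rewrite !dotpDr !dotpZr ji lerD2l ler_pM2l // him //.
  by apply/max_gensP => l; rewrite ji; move/max_gensP: hi; exact.
Qed.

(** Among the faces with two distinct vertices contained in the given one, a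
    minimal one is an edge.  It has a proper face, which minimality makes a
    vertex [u], cut out by [d0].  If the face were not contained in a line
    through [u], rotating [d0] about the orthogonal complement of another vertex
    direction until a further generator ties with [u] would produce a smaller
    face that is not a point. *)
Lemma exists_edge c i j :
  i \in max_gens c -> j \in max_gens c -> v i <> v j ->
  exists c' a b, [/\ a != b, face (hull v) c' = segment a b,
                     face (hull v) c a & face (hull v) c b].
Proof.
move=> ci cj vij.
pose wide (S : {set 'I_k.+1}) :=
  `[< (exists c', max_gens c' = S) /\
      exists i j, [/\ i \in S, j \in S & v i <> v j] >].
have /minset_exists[S /minsetP[/asboolP[[c' <-] [i0 [j0 [Si Sj wij]]]] Smin] Sc] :
    wide (max_gens c).
  by apply/asboolP; split; [exists c|exists i, j].
(* Minimality: on this face [d] is either maximized by a single vertex or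
   constant. *)
have shrink d : exists2 m, m \in max_gens c' &
    (forall l, l \in max_gens c' -> dotp (v l) d <= dotp (v m) d) /\
    forall l, l \in max_gens c' -> dotp (v l) d = dotp (v m) d ->
      v l = v m \/ forall l', l' \in max_gens c' -> dotp (v l') d = dotp (v m) d.
  have [c2 c2P] := max_gens_perturb c' d.
  have [m m2] := max_gens_neq0 c2; have /c2P[m1 mm] := m2.
  exists m => //; split=> // l Sl lm.
  have [|vlm] := pselect (v l = v m); first by left.
  right=> l' Sl'.
  have l2 : l \in max_gens c2 by apply/c2P; split => // ? ?; rewrite lm mm.
  have E : max_gens c2 = max_gens c'.
    apply: Smin; last by apply/fintype.subsetP => ? /c2P[].
    by apply/asboolP; split; [exists c2|exists l, m].
  have : l' \in max_gens c2 by rewrite E.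
  by move=> /c2P[_ /(_ m m1) h]; apply/eqP; rewrite eq_le h mm.
pose d0 := v i0 - v j0.
have [m Sm [mm mu]] := shrink d0; pose u := v m.
have d0ij : dotp (v j0) d0 < dotp (v i0) d0.
  by rewrite -subr_gt0 -dotpBl dotpp_gt0 // subr_eq0; apply/eqP.
have d0j : dotp (v j0 - u) d0 < 0.
  by rewrite dotpBl subr_lt0; exact: lt_le_trans d0ij (mm _ Si).
set e := v j0 - u in d0j.
have e0 : e != 0 by apply: contraTneq d0j => ->; rewrite dotp0l ltxx.
have ee : 0 < dotp e e by exact: dotpp_gt0.
pose t i := dotp (v i - u) e / dotp e e.
have line l : l \in max_gens c' -> v l - u = t l *: e.
  move=> Sl; apply: contrapT => nl; pose d1 := v l - u - t l *: e.
  have d1N0 : d1 != 0 by rewrite subr_eq0; apply/eqP.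
  have ed1 : dotp e d1 = 0.
    rewrite dotpBr dotpZr (dotpC e (v l - u)) /t; field; exact: lt0r_neq0.
  have ld1 : 0 < dotp (v l - u) d1.
    have -> : v l - u = d1 + t l *: e by rewrite subrK.
    by rewrite dotpDl dotpZl ed1 mulr0 addr0 dotpp_gt0.
  (* [d0 + s *: d1] is maximized at [u] and [v r], but not at [v j0]. *)
  have [|s [r [s0 Sr rd1 rs sle]]] := @first_crossing R _ (mem (max_gens c'))
      (fun i => dotp (v i - u) d0) (fun i => dotp (v i - u) d1) l _ Sl ld1.
    by move=> p Sp; rewrite dotpBl subr_le0 mm.
  have sE p : dotp (v p - u) (d0 + s *: d1) =
      dotp (v p - u) d0 + s * dotp (v p - u) d1 by rewrite dotpDr dotpZr.
  have [m' Sm' [mm' mu']] := shrink (d0 + s *: d1).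
  have mum : dotp (v m') (d0 + s *: d1) = dotp u (d0 + s *: d1).
    apply/eqP; rewrite eq_le mm' // andbT -subr_le0 -dotpBl sE; exact: sle.
  have rum : dotp (v r) (d0 + s *: d1) = dotp u (d0 + s *: d1).
    by apply/eqP; rewrite -subr_eq0 -dotpBl sE rs.
  have all_tie : forall l', l' \in max_gens c' ->
      dotp (v l') (d0 + s *: d1) = dotp u (d0 + s *: d1).
    have [um|um] := mu' m Sm (esym mum); last first.
      by move=> l' Sl'; rewrite um.
    have [rm|rm] := mu' r Sr (etrans rum (esym mum)); last first.
      by move=> l' Sl'; rewrite rm.
    by move: rd1; rewrite rm -um subrr dotp0l ltxx.
  have := all_tie _ Sj; move/eqP; rewrite -subr_eq0 -dotpBl sE -/e ed1 mulr0 addr0.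
  by rewrite lt_eqF.
have t0 l : l \in max_gens c' -> 0 <= t l.
  move=> Sl; have := mm l Sl; rewrite -subr_le0 -dotpBl -/u line // dotpZl.
  by rewrite nmulr_lle0.
have tj : t j0 = 1 by rewrite /t divff // gt_eqF.
(* The other end of the edge is the generator furthest from [u]. *)
have [r Sr rm] : exists2 r, r \in max_gens c' &
    forall l, l \in max_gens c' -> t l <= t r.
  by exists [arg max_(r > j0 in max_gens c') t r]%O; case: arg_maxP.
have tr : 0 < t r by apply: lt_le_trans (rm _ Sj); rewrite tj.
have face_c p : p \in max_gens c' -> face (hull v) c (v p).
  by move=> Sp; apply: max_gens_face; exact: (fintype.subsetP Sc).
exists c', u, (v r); split; [|  |exact: face_c|exact: face_c].
  rewrite eq_sym -subr_eq0 line // scaler_eq0 negb_or e0 andbT gt_eqF //.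
rewrite (face_hull (max_gens_face Sm)); set w := fun i => _.
have wS p : exists2 l, l \in max_gens c' & w p = v l.
  rewrite /w; case: eqP => [E|_]; last by exists m.
  by exists p => //; apply/max_gensP => q; rewrite E; move/max_gensP: Sm; exact.
have Sw l : l \in max_gens c' -> w l = v l.
  by move=> Sl; rewrite /w (max_gens_eq Sl Sm) eqxx.
apply/seteqP; split => x.
- move=> [a [a0 a1 ->]].
  pose f p := t (projT1 (cid2 (wS p))) / t r.
  have fP p : 0 <= f p <= 1 /\ w p = u + f p *: (v r - u).
    rewrite /f; case: cid2 => l Sl /= ->; split.
      by rewrite divr_ge0 ?t0 // ler_pdivrMr // mul1r rm.
    by rewrite (line r Sr) scalerA divfK ?gt_eqF // -(line l Sl) addrC subrK.
  exists (\sum_p a p * f p) => /=.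
    apply/andP; split.
      by apply: sumr_ge0 => p _; rewrite mulr_ge0 //; case: (fP p) => /andP[].
    rewrite -a1; apply: ler_sum => p _; rewrite ler_piMr //.
    by case: (fP p) => /andP[].
  have uE : u = \sum_p a p *: u by rewrite -scaler_suml a1 scale1r.
  rewrite scaler_suml {1}uE -big_split; apply: eq_bigr => p _ /=.
  by rewrite (fP p).2 [in RHS]scalerDr scalerA.
- move=> [s s01 <-]; rewrite -(Sw _ Sr); apply: hull_toward => //.
  by rewrite -[u](Sw _ Sm); exact: hull_gen.
Qed.

End MaximalGenerators.

End Edges.

(** * Braid cones and the vertices they select *)

Section Braid.
Variables (R : realType) (n : nat).
Implicit Types (x y c d : 'rV[R]_n) (s : 'S_n) (P A B : set 'rV[R]_n).

Definition strict_braid s c := forall i j : 'I_n, (i < j)%N -> c 0 (s i) < c 0 (s j).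

Lemma strict_braidW s c : strict_braid s c -> braid_cone s c.
Proof.
move=> hc i j; rewrite leq_eqVlt => /orP[/eqP/val_inj-> //|/hc/ltW //].
Qed.

Lemma strict_braid_inj s c i j : strict_braid s c -> c 0 i = c 0 j -> i = j.
Proof.
move=> hc cij; rewrite -(permKV s i) -(permKV s j) in cij *; congr (s _).
by have [/hc|/hc|/val_inj //] := ltngtP (s^-1 i)%g (s^-1 j)%g; rewrite cij ltxx.
Qed.

Lemma strict_braidD s c d t : strict_braid s c -> braid_cone s d -> 0 <= t ->
  strict_braid s (c + t *: d).
Proof.
by move=> hc hd t0 i j ij; rewrite !mxE ltr_leD ?hc // ler_wpM2l // hd // ltnW.
Qed.

Lemma exists_strict_braid s : exists c, strict_braid s c.
Proof.
exists (\row_i ((s^-1)%g i)%:R) => i j ij.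
by rewrite !mxE !permK ltr_nat.
Qed.

Lemma strict_braid_perturb s c d : strict_braid s c ->
  exists2 e, 0 < e & strict_braid s (c + e *: d).
Proof.
move=> hc; have [e e0 he] := small_perturbation
  (fun ij : 'I_n * 'I_n => c 0 (s ij.2) - c 0 (s ij.1))
  (fun ij => d 0 (s ij.2) - d 0 (s ij.1)).
exists e => // i j ij; have := he (i, j); rewrite /= subr_gt0 hc // => /(_ isT).
rewrite !mxE; lra.
Qed.

Lemma interior_braid_cone s : interior (@braid_cone R n s) = strict_braid s.
Proof.
apply/seteqP; split => c.
- move=> /nbhs_ballP[e /= e0 he] i j ij.
  have : braid_cone s (c + (e / 2) *: delta_mx 0 (s i)).
    apply: he; split=> // l l'; rewrite !mxE /ball /= opprD addrA subrr sub0r normrN.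
    rewrite ger0_norm; last by rewrite mulr_ge0 ?ler0n // ltW // divr_gt0.
    apply: (@le_lt_trans _ _ (e / 2 * 1)); last lra.
    by rewrite ler_wpM2l ?lern1 ?leq_b1 //; lra.
  move=> /(_ i j (ltnW ij)); rewrite !mxE !eqxx /=.
  have -> : (s j == s i) = false by rewrite (inj_eq perm_inj) -val_eqE gtn_eqF.
  rewrite /= mulr1n mulr0n; lra.
- move=> hc; have [|e e0 he] := @uniform_lower_bound R _
    (fun ij : 'I_n * 'I_n => if (ij.1 < ij.2)%N
       then c 0 (s ij.2) - c 0 (s ij.1) else 1).
    by move=> ij; case: ifP => // ij'; rewrite subr_gt0 hc.
  apply/nbhs_ballP; exists (e / 2) => /=; first by rewrite divr_gt0.
  move=> d hd i j; rewrite leq_eqVlt => /orP[/eqP/val_inj-> //|ij].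
  have := he (i, j); rewrite /= ij.
  have := hd.2 0 (s i); have := hd.2 0 (s j); rewrite /ball /= !ltr_distl; lra.
Qed.

Lemma exists_braid_cone c : exists s, braid_cone s c.
Proof.
pose t := [tuple c 0 i | i < n].
have /tuple_permP[s sE] : perm_eq (sort <=%R t) t by rewrite perm_sort.
exists s => i j ij.
have := @le_sorted_leq_nth _ _ 0 (sort <=%R t) (sort_le_sorted _).
move=> /(_ i j); rewrite !inE size_sort size_tuple => /(_ (ltn_ord i) (ltn_ord j) ij).
by rewrite sE -!tnth_nth !tnth_mktuple.
Qed.

(** Maximality on the closed cone: on the interior it makes [v] the only maximizer
    ([braid_vertex_face]), so that [v] is [P^s], while Minkowski sums and
    summands can be treated without any uniqueness. *)
Definition braid_vertex P s v :=
  P v /\ forall c, braid_cone s c -> forall y, P y -> dotp y c <= dotp v c.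

Lemma braid_vertex_face P s v c :
  braid_vertex P s v -> strict_braid s c -> face P c = [set v].
Proof.
move=> [Pv vm] hc; have {}vm := fun c' hc' => vm c' (strict_braidW hc').
apply/seteqP; split => [w [Pw wm]|_ ->]; last by split=> // y; exact: vm.
have [e e0 /vm/(_ w Pw)] := strict_braid_perturb (w - v) hc.
rewrite !dotpDr !dotpZr; have := wm v Pv; have := vm c hc w Pw => h1 h2 h3.
have : e * dotp (w - v) (w - v) <= 0 by rewrite dotpBl; lra.
rewrite pmulr_rle0 // => h; apply/eqP; rewrite -subr_eq0; apply/eqP.
by apply: dotpp_eq0; apply/eqP; rewrite eq_le h dotpp_ge0.
Qed.

Lemma perm_vertexE P s v : braid_vertex P s v -> perm_vertex P s = v.
Proof.
move=> hv; apply: xget_unique => [c|w hw].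
  by rewrite interior_braid_cone; exact: braid_vertex_face.
have [c hc] := exists_strict_braid s.
have := hw c; rewrite interior_braid_cone => /(_ hc).
by rewrite (braid_vertex_face hv hc) => /seteqP[_ /(_ _ erefl) ->].
Qed.

(** If a strict functional had two maximizers, it would be constant on an edge,
    which the direction of edges forbids; the vertex does not depend on the
    strict functional, for otherwise some functional in between would have two
    maximizers. *)
Lemma deformed_braid_vertex P s :
  deformed_permutahedron P -> exists v, braid_vertex P s v.
Proof.
move=> [[k [v ->]] edges]; rewrite -[conv_hull v]/(hull v) in edges *.
have uniq c i j : strict_braid s c -> i \in max_gens v c -> j \in max_gens v c ->
    v i = v j.
  move=> hc hi hj; apply: contrapT => vij.
  have [c' [a [b [ab fE fa fb]]]] := exists_edge hi hj vij.
  have [p [q [t E]]] := edges _ _ _ ab fE.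
  have abc : dotp (b - a) c = 0.
    by apply/eqP; rewrite dotpBl subr_eq0 eq_le fa.2 ?fb.2 //; [case: fa|case: fb].
  have ba : b - a != 0 by rewrite subr_eq0 eq_sym.
  move: abc ba; rewrite E dotpZl dotpBl ![dotp (delta_mx _ _) _]dotpC !dotp_delta.
  move=> /eqP; rewrite mulf_eq0 subr_eq0 => /orP[/eqP->|/eqP/(strict_braid_inj hc)->].
    by rewrite scale0r eqxx.
  by rewrite subrr scaler0 eqxx.
have [c0 hc0] := exists_strict_braid s.
have [m m0] := max_gens_neq0 v c0.
exists (v m); split=> [|c hc y]; first exact: hull_gen.
apply: hull_le => i; rewrite leNgt; apply/negP => mi.
have mj j : predT j -> dotp (v j - v m) c0 <= 0.
  by move=> _; rewrite dotpBl subr_le0; move/max_gensP: m0; exact.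
have ci : 0 < dotp (v i - v m) c by rewrite dotpBl subr_gt0.
have [t [r [t0 _ rc rt tm]]] := @first_crossing R _ predT _
  (fun i => dotp (v i - v m) c) i mj isT ci.
have E j : dotp (v j) (c0 + t *: c) <= dotp (v m) (c0 + t *: c).
  by rewrite -subr_le0 -dotpBl dotpDr dotpZr tm.
have Er : dotp (v r) (c0 + t *: c) = dotp (v m) (c0 + t *: c).
  by apply/eqP; rewrite -subr_eq0 -dotpBl dotpDr dotpZr rt.
have hm : m \in max_gens v (c0 + t *: c) by apply/max_gensP.
have hr : r \in max_gens v (c0 + t *: c) by apply/max_gensP => j; rewrite Er.
have := uniq _ _ _ (strict_braidD hc0 hc t0) hr hm => vrm.
by move: rc; rewrite vrm subrr dotp0l ltxx.
Qed.

End Braid.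

(** * Minkowski sums and dilations *)

Section MinkowskiAlgebra.
Variables (R : realType) (n : nat).
Implicit Types (x y c d t : 'rV[R]_n) (s : 'S_n) (P Q A B S : set 'rV[R]_n).

Lemma msumC A B : msum A B = msum B A.
Proof.
by apply/seteqP; split => _ [a Aa [b Bb <-]]; exists b => //; exists a => //;
  rewrite addrC.
Qed.

Lemma msumA A B S : msum A (msum B S) = msum (msum A B) S.
Proof.
apply/seteqP; split.
- move=> _ [a Aa [_ [b Bb [s Ss <-]] <-]]; exists (a + b); first by exists a => //; exists b.
  by exists s => //; rewrite addrA.
- move=> _ [_ [a Aa [b Bb <-]] [s Ss <-]]; exists a => //; exists (b + s).
    by exists b => //; exists s.
  by rewrite addrA.
Qed.

Lemma msum_point x y : msum [set x] [set y] = [set x + y].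
Proof.
apply/seteqP; split=> [_ [_ -> [_ -> <-]] //|_ ->].
by exists x => //; exists y.
Qed.

Lemma msum0 A : msum A [set 0] = A.
Proof.
apply/seteqP; split=> [_ [a Aa [_ -> <-]]|a Aa]; first by rewrite addr0.
by exists a => //; exists 0; rewrite ?addr0.
Qed.

Lemma dilate_msum a A B : dilate a (msum A B) = msum (dilate a A) (dilate a B).
Proof.
apply/seteqP; split.
- move=> _ [_ [x Ax [y By <-]] <-]; exists (a *: x); first by exists x.
  by exists (a *: y); [exists y|rewrite scalerDr].
- move=> _ [_ [x Ax <-] [_ [y By <-] <-]]; exists (x + y); last by rewrite scalerDr.
  by exists x => //; exists y.
Qed.

Lemma dilateA a b A : dilate a (dilate b A) = dilate (a * b) A.
Proof.
apply/seteqP; split=> [_ [_ [x Ax <-] <-]|_ [x Ax <-]].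
  by exists x => //; rewrite scalerA.
by exists (b *: x); [exists x|rewrite scalerA].
Qed.

Lemma dilate1 A : dilate 1 A = A.
Proof.
by apply/seteqP; split=> [_ [x Ax <-]|x Ax]; [rewrite scale1r|exists x; rewrite ?scale1r].
Qed.

Lemma dilate_point a x : dilate a [set x] = [set a *: x].
Proof. by apply/seteqP; split=> [_ [_ -> <-] //|_ ->]; exists x. Qed.

Lemma dilate0 A : A !=set0 -> dilate 0 A = [set 0].
Proof.
move=> [x Ax]; apply/seteqP; split=> [_ [y _ <-]|_ ->]; first by rewrite scale0r.
by exists x => //; rewrite scale0r.
Qed.

Lemma face_msum A B c : face (msum A B) c = msum (face A c) (face B c).
Proof.
apply/seteqP; split.
- move=> _ [[a Aa [b Bb <-]] abm]; exists a.
    split=> // y Ay; have := abm (y + b); rewrite !dotpDl lerD2r; apply.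
    by exists y => //; exists b.
  exists b => //; split=> // y By; have := abm (a + y); rewrite !dotpDl lerD2l; apply.
  by exists a => //; exists y.
- move=> _ [a [Aa am] [b [Bb bm] <-]]; split; first by exists a => //; exists b.
  by move=> _ [y Ay [z Bz <-]]; rewrite !dotpDl lerD ?am ?bm.
Qed.

Lemma face_point x c : face [set x] c = [set x].
Proof. by apply/seteqP; split=> [y []//|_ ->]; split=> // y ->. Qed.

Lemma face_dilate a A c : 0 < a -> face (dilate a A) c = dilate a (face A c).
Proof.
move=> a0; apply/seteqP; split.
- move=> _ [[x Ax <-] xm]; exists x => //; split=> // y Ay.
  by have := xm (a *: y); rewrite !dotpZl ler_pM2l //; apply; exists y.
- move=> _ [x [Ax xm] <-]; split; first by exists x.
  by move=> _ [y Ay <-]; rewrite !dotpZl ler_pM2l // xm.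
Qed.

Lemma dotp_const x (a : R) : dotp x (const_mx a) = a * \sum_i x 0 i.
Proof. by rewrite mulr_sumr; apply: eq_bigr => i _; rewrite mxE mulrC. Qed.

Lemma top_faceE A : top_face A = face A (const_mx 1).
Proof.
apply/seteqP; split=> x [Ax xm]; split=> // y Ay; move: (xm y Ay);
  by rewrite !dotp_const !mul1r.
Qed.

Lemma bottom_faceE A : bottom_face A = face A (const_mx (- 1)).
Proof.
apply/seteqP; split=> x [Ax xm]; split=> // y Ay; move: (xm y Ay);
  by rewrite !dotp_const !mulN1r lerN2.
Qed.

(** Normal cones, hence the normal fan, only see a polytope up to positive
    dilation and translation. *)
Lemma normal_fan_dilate a A : 0 < a -> normal_fan (dilate a A) = normal_fan A.
Proof.
move=> a0; rewrite /normal_fan; congr [set _ | _ in _]; apply/funext => c0.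
apply/seteqP; split => c /=; rewrite !face_dilate // => h x.
- move=> xc0; have [|y yc /(scalerI (lt0r_neq0 a0)) <- //] := h (a *: x).
  by exists x.
- by move=> [y /h yc <-]; exists y.
Qed.

Lemma normal_fan_translate A t : normal_fan (msum A [set t]) = normal_fan A.
Proof.
rewrite /normal_fan; congr [set _ | _ in _]; apply/funext => c0.
apply/seteqP; split => c /=; rewrite !face_msum !face_point => h x.
- move=> xc0; have [|y yc [_ -> /addIr <- //]] := h (x + t).
  by exists x => //; exists t.
- by move=> [y /h yc [_ -> <-]]; exists y => //; exists t.
Qed.

End MinkowskiAlgebra.

(** * Polytopes with one vertex per braid cone *)

Section BraidPolytopes.
Variables (R : realType) (n : nat).
Implicit Types (x y c d t : 'rV[R]_n) (s : 'S_n) (P Q A B S : set 'rV[R]_n).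

Lemma braid_vertex_msum A B s v w : braid_vertex A s v -> braid_vertex B s w ->
  braid_vertex (msum A B) s (v + w).
Proof.
move=> [Av vm] [Bw wm]; split; first by exists v => //; exists w.
by move=> c hc _ [x Ax [y By <-]]; rewrite !dotpDl lerD ?vm ?wm.
Qed.

Lemma braid_vertex_dilate a A s v : 0 <= a -> braid_vertex A s v ->
  braid_vertex (dilate a A) s (a *: v).
Proof.
move=> a0 [Av vm]; split; first by exists v.
by move=> c hc _ [x Ax <-]; rewrite !dotpZl ler_wpM2l ?vm.
Qed.

Lemma braid_vertex_point t s : braid_vertex [set t] s t.
Proof. by split=> // c _ y ->. Qed.

(** The polytopes for which [P^s] makes sense.  By [deformed_braid_vertex] they
    include the deformed permutahedra; stability under Minkowski summands is
    immediate in this form. *)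
Definition braid_polytope P := polytope P /\ forall s, exists v, braid_vertex P s v.

Lemma deformed_braid_polytope P : deformed_permutahedron P -> braid_polytope P.
Proof. by move=> dP; split=> [|s]; [case: dP|exact: deformed_braid_vertex]. Qed.

Lemma perm_vertexP P s : braid_polytope P -> braid_vertex P s (perm_vertex P s).
Proof. by move=> [_ /(_ s)[v hv]]; rewrite (perm_vertexE hv). Qed.

Lemma perm_vertex_in P s : braid_polytope P -> P (perm_vertex P s).
Proof. by move=> /(perm_vertexP s)[]. Qed.

Lemma braid_polytope_msum A B : braid_polytope A -> braid_polytope B ->
  braid_polytope (msum A B).
Proof.
move=> [pA hA] [pB hB]; split=> [|s]; first exact: msum_polytope.
by have [v hv] := hA s; have [w hw] := hB s; exists (v + w); exact: braid_vertex_msum.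
Qed.

Lemma braid_polytope_dilate a A : 0 <= a -> braid_polytope A ->
  braid_polytope (dilate a A).
Proof.
move=> a0 [pA hA]; split=> [|s]; first exact: dilate_polytope.
by have [v hv] := hA s; exists (a *: v); exact: braid_vertex_dilate.
Qed.

Lemma braid_polytope_point t : braid_polytope [set t].
Proof.
by split=> [|s]; [exact: point_polytope|exists t; exact: braid_vertex_point].
Qed.

Lemma braid_polytope_summand A B : polytope A -> braid_polytope (msum A B) ->
  braid_polytope A.
Proof.
move=> pA [_ h]; split=> // s; have [_ [[a Aa [b Bb <-]] vm]] := h s.
exists a; split=> // c hc y Ay; have := vm c hc (y + b); rewrite !dotpDl lerD2r.
by apply; exists y => //; exists b.
Qed.

Lemma perm_vertex_msum A B s : braid_polytope A -> braid_polytope B ->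
  perm_vertex (msum A B) s = perm_vertex A s + perm_vertex B s.
Proof.
by move=> hA hB; apply: perm_vertexE; apply: braid_vertex_msum; exact: perm_vertexP.
Qed.

Lemma perm_vertex_dilate a A s : 0 <= a -> braid_polytope A ->
  perm_vertex (dilate a A) s = a *: perm_vertex A s.
Proof.
by move=> a0 hA; apply: perm_vertexE; apply: braid_vertex_dilate => //; exact: perm_vertexP.
Qed.

Lemma perm_vertex_point t s : perm_vertex [set t] s = t.
Proof. by apply: perm_vertexE; exact: braid_vertex_point. Qed.

(** Constant vectors and their opposites lie in every braid cone. *)
Lemma braid_polytope_sum P x y : braid_polytope P -> P x -> P y ->
  \sum_i x 0 i = \sum_i y 0 i.
Proof.
move=> hP; suff E z : P z -> \sum_i z 0 i = \sum_i perm_vertex P 1%g 0 i.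
  by move=> /E-> /E->.
move=> Pz; have [_ vm] := perm_vertexP 1%g hP.
have hc a : braid_cone 1%g (const_mx a : 'rV[R]_n) by move=> i j _; rewrite !mxE.
have := vm _ (hc 1) z Pz; have := vm _ (hc (- 1)) z Pz; rewrite !dotp_const; lra.
Qed.

Lemma braid_polytope_hull P : braid_polytope P -> P = hull (perm_vertex P).
Proof.
move=> hP; apply/seteqP; split.
- apply: sub_polytope; first exact: (hull_polytope 1%g).
  move=> c; have [s hs] := exists_braid_cone c.
  exists (perm_vertex P s); first exact: hull_gen.
  by move=> y; apply: (perm_vertexP s hP).2.
- by apply: polytope_hull_sub => [|s]; [case: hP|exact: perm_vertex_in].
Qed.

Lemma deformation_braid_polytope A P : deformation A P -> braid_polytope P ->
  braid_polytope A.
Proof.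
move=> [pA [a [S [a0 _ E]]]] hP; apply: (@braid_polytope_summand A S) => //.
by rewrite E; apply: braid_polytope_dilate => //; exact: ltW.
Qed.

End BraidPolytopes.

(** * GP-sums *)

Section GPSum.
Variables (R : realType) (n : nat).
Implicit Types (x y c d t : 'rV[R]_n) (s : 'S_n) (P Q A B : set 'rV[R]_n).

Definition pos_part c : 'rV[R]_n := \row_i Num.max (c 0 i) 0.
Definition neg_part c : 'rV[R]_n := \row_i Num.min (c 0 i) 0.

Lemma pos_neg_part c : c = pos_part c + neg_part c.
Proof. by apply/rowP => i; rewrite !mxE addr_max_min addr0. Qed.

Lemma braid_cone_pos_part s c : braid_cone s c -> braid_cone s (pos_part c).
Proof. by move=> hc i j /hc; rewrite !mxE => cij; rewrite ge_max !le_max cij lexx orbT. Qed.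

Lemma braid_cone_neg_part s c : braid_cone s c -> braid_cone s (neg_part c).
Proof. by move=> hc i j /hc; rewrite !mxE => cij; rewrite le_min !ge_min cij lexx orbT. Qed.

Lemma dotp_pos_part_le x y c : (forall i, x 0 i <= y 0 i) ->
  dotp x (pos_part c) <= dotp y (pos_part c).
Proof.
by move=> xy; apply: ler_sum => i _; rewrite ler_wpM2r ?xy // mxE le_max lexx orbT.
Qed.

Lemma dotp_neg_part_le x y c : (forall i, y 0 i <= x 0 i) ->
  dotp x (neg_part c) <= dotp y (neg_part c).
Proof.
by move=> xy; apply: ler_sum => i _; rewrite ler_wnM2r ?xy // mxE ge_min lexx orbT.
Qed.

Lemma gp_sum_lower Q P x : gp_sum Q P x -> exists2 q, Q q & forall i, q 0 i <= x 0 i.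
Proof.
move=> [[q Qq [r r0 <-]] _]; exists q => // i.
by rewrite mxE lerDl.
Qed.

Lemma gp_sum_upper Q P x : gp_sum Q P x -> exists2 p, P p & forall i, x 0 i <= p 0 i.
Proof.
move=> [_ [p Pp [r r0 <-]]]; exists p => // i.
by rewrite mxE gerDl.
Qed.

Lemma in_gp_sum Q P x q p : Q q -> P p -> (forall i, q 0 i <= x 0 i) ->
  (forall i, x 0 i <= p 0 i) -> gp_sum Q P x.
Proof.
move=> Qq Pp qx xp; split.
- by exists q => //; exists (x - q) => [i|]; [rewrite !mxE subr_ge0|rewrite addrC subrK].
- by exists p => //; exists (x - p) => [i|]; [rewrite !mxE subr_le0|rewrite addrC subrK].
Qed.

(** For [c] in the braid cone of [s] and [Q] dominated by [P], this is the value at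
    [c] of the support function of [gp_sum Q P]: see [gp_sum_le] for the upper
    bound, [gp_vertex_in] and [gp_vertex_support] for a point attaining it. *)
Definition gp_support Q P s c :=
  dotp (perm_vertex P s) (pos_part c) + dotp (perm_vertex Q s) (neg_part c).

Lemma gp_sum_pos_part Q P s c y : braid_polytope P -> braid_cone s c ->
  gp_sum Q P y -> dotp y (pos_part c) <= dotp (perm_vertex P s) (pos_part c).
Proof.
move=> hP hc /gp_sum_upper[p Pp yp]; apply: le_trans (dotp_pos_part_le _ yp) _.
by apply: (perm_vertexP s hP).2 => //; exact: braid_cone_pos_part.
Qed.

Lemma gp_sum_neg_part Q P s c y : braid_polytope Q -> braid_cone s c ->
  gp_sum Q P y -> dotp y (neg_part c) <= dotp (perm_vertex Q s) (neg_part c).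
Proof.
move=> hQ hc /gp_sum_lower[q Qq qy]; apply: le_trans (dotp_neg_part_le _ qy) _.
by apply: (perm_vertexP s hQ).2 => //; exact: braid_cone_neg_part.
Qed.

Lemma gp_sum_le Q P s c y : braid_polytope Q -> braid_polytope P ->
  braid_cone s c -> gp_sum Q P y -> dotp y c <= gp_support Q P s c.
Proof.
move=> hQ hP hc hy; rewrite {1}(pos_neg_part c) dotpDr lerD //.
  exact: gp_sum_pos_part hy.
exact: gp_sum_neg_part hy.
Qed.

(** When [Q] is dominated by [P], every vertex of [gp_sum Q P] has this form, the
    coordinates taken from [P^s] being those on which the maximized functional is
    positive ([gp_vertex_support]). *)
Definition gp_vertex Q P (sT : 'S_n * {set 'I_n}) : 'rV[R]_n :=
  \row_i (if i \in sT.2 then perm_vertex P sT.1 0 i else perm_vertex Q sT.1 0 i).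

Lemma gp_vertex_support Q P s c :
  dotp (gp_vertex Q P (s, [set i | 0 < c 0 i]%SET)) c = gp_support Q P s c.
Proof.
rewrite /gp_support /dotp -big_split; apply: eq_bigr => i _ /=.
rewrite !mxE inE; have [ci|ci] := ltP 0 (c 0 i).
  by rewrite mulr0 addr0.
by rewrite mulr0 add0r.
Qed.

Lemma gp_vertex_in Q P sT : braid_polytope Q -> braid_polytope P -> dominated Q P ->
  gp_sum Q P (gp_vertex Q P sT).
Proof.
case: sT => s T hQ hP QP.
apply: (in_gp_sum (perm_vertex_in s hQ) (perm_vertex_in s hP)) => i;
  by rewrite mxE /=; case: ifP.
Qed.

Lemma gp_sum_hull Q P : braid_polytope Q -> braid_polytope P -> dominated Q P ->
  gp_sum Q P = hull (gp_vertex Q P).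
Proof.
move=> hQ hP QP; apply/seteqP; split.
- apply: sub_polytope; first exact: (hull_polytope (1%g, finset.set0)).
  move=> c; have [s hs] := exists_braid_cone c.
  exists (gp_vertex Q P (s, [set i | 0 < c 0 i]%SET)); first exact: hull_gen.
  by move=> y; rewrite gp_vertex_support; exact: gp_sum_le.
- move=> x [a [a0 a1 ->]]; set y := \sum_i _.
  have hv sT := gp_vertex_in sT hQ hP QP.
  pose q := \sum_sT a sT *: perm_vertex Q sT.1.
  pose p := \sum_sT a sT *: perm_vertex P sT.1.
  have comb A : braid_polytope A -> A (\sum_sT a sT *: perm_vertex A sT.1).
    move=> hA; apply: (@polytope_hull_sub _ _ A _ (fun sT => perm_vertex A sT.1)).
    - by case: hA.
    - by move=> sT; exact: perm_vertex_in.
    - by exists a.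
  apply: (in_gp_sum (comb Q hQ) (comb P hP)) => i; rewrite !summxE;
    apply: ler_sum => -[s T] _; rewrite !mxE ler_wpM2l //=; by case: ifP.
Qed.

Lemma gp_sum_polytope Q P : braid_polytope Q -> braid_polytope P ->
  dominated Q P -> polytope (gp_sum Q P).
Proof.
by move=> hQ hP QP; rewrite gp_sum_hull //; exact: (hull_polytope (1%g, finset.set0)).
Qed.

Lemma sub_gp_sum_top Q P : braid_polytope Q -> braid_polytope P ->
  dominated Q P -> P `<=` gp_sum Q P.
Proof.
move=> hQ hP QP x; rewrite {1}(braid_polytope_hull hP); apply: polytope_hull_sub.
  exact: gp_sum_polytope.
move=> s; apply: (in_gp_sum (perm_vertex_in s hQ) (perm_vertex_in s hP)) => // i.
Qed.

Lemma sub_gp_sum_bottom Q P : braid_polytope Q -> braid_polytope P ->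
  dominated Q P -> Q `<=` gp_sum Q P.
Proof.
move=> hQ hP QP x; rewrite {1}(braid_polytope_hull hQ); apply: polytope_hull_sub.
  exact: gp_sum_polytope.
move=> s; apply: (in_gp_sum (perm_vertex_in s hQ) (perm_vertex_in s hP)) => // i.
Qed.

Lemma eq_from_le_sum x y : (forall i, x 0 i <= y 0 i) ->
  \sum_i y 0 i <= \sum_i x 0 i -> x = y.
Proof.
move=> xy yx; apply/rowP => i; apply/eqP; rewrite eq_sym -subr_eq0.
have /eqP : \sum_i (y 0 i - x 0 i) = 0.
  by apply/eqP; rewrite eq_le sumr_ge0 ?andbT ?sumrB ?subr_le0 // => j _; rewrite subr_ge0.
rewrite psumr_eq0 => [/allP/(_ i (mem_index_enum _))//|j _].
by rewrite subr_ge0.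
Qed.

Lemma gp_sum_top Q P : braid_polytope Q -> braid_polytope P ->
  dominated Q P -> top_face (gp_sum Q P) = P.
Proof.
move=> hQ hP QP; have PX := sub_gp_sum_top hQ hP QP.
apply/seteqP; split => [x [hx xm]|x Px].
- have [p Pp xp] := gp_sum_upper hx.
  by rewrite (eq_from_le_sum xp (xm p (PX p Pp))).
- split=> [|y /gp_sum_upper[p Pp yp]]; first exact: PX.
  by rewrite (braid_polytope_sum hP Px Pp); exact: ler_sum.
Qed.

Lemma gp_sum_bottom Q P : braid_polytope Q -> braid_polytope P ->
  dominated Q P -> bottom_face (gp_sum Q P) = Q.
Proof.
move=> hQ hP QP; have QX := sub_gp_sum_bottom hQ hP QP.
apply/seteqP; split => [x [hx xm]|x Qx].
- have [q Qq qx] := gp_sum_lower hx.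
  by rewrite -(eq_from_le_sum qx (xm q (QX q Qq))).
- split=> [|y /gp_sum_lower[q Qq qy]]; first exact: QX.
  by rewrite (braid_polytope_sum hQ Qx Qq); exact: ler_sum.
Qed.

Lemma gp_sum_translate Q P t :
  gp_sum (msum Q [set t]) (msum P [set t]) = msum (gp_sum Q P) [set t].
Proof.
apply/seteqP; split=> x.
- move=> hx; have [_ [q Qq [_ -> <-]] qx] := gp_sum_lower hx.
  have [_ [p Pp [_ -> <-]] xp] := gp_sum_upper hx.
  exists (x - t); last by exists t => //; rewrite subrK.
  apply: (in_gp_sum Qq Pp) => i; first by have := qx i; rewrite !mxE lerBrDr.
  by have := xp i; rewrite !mxE lerBlDr.
- move=> [y hy [_ -> <-]]; have [q Qq qx] := gp_sum_lower hy.
  have [p Pp xp] := gp_sum_upper hy.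
  apply: (@in_gp_sum _ _ _ (q + t) (p + t)).
  + by exists q => //; exists t.
  + by exists p => //; exists t.
  + by move=> i; rewrite !mxE lerD2r.
  + by move=> i; rewrite !mxE lerD2r.
Qed.

Lemma gp_sum_dilate a Q P : 0 < a ->
  gp_sum (dilate a Q) (dilate a P) = dilate a (gp_sum Q P).
Proof.
move=> a0; apply/seteqP; split=> x.
- move=> hx; have [_ [q Qq <-] qx] := gp_sum_lower hx.
  have [_ [p Pp <-] xp] := gp_sum_upper hx.
  exists (a^-1 *: x); last by rewrite scalerA divff ?scale1r // gt_eqF.
  apply: (in_gp_sum Qq Pp) => i.
    by have := qx i; rewrite !mxE mulrC -ler_pdivlMr // mulrC.
  by have := xp i; rewrite !mxE [a * _]mulrC -ler_pdivrMr // mulrC.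
- move=> [y hy <-]; have [q Qq qx] := gp_sum_lower hy.
  have [p Pp xp] := gp_sum_upper hy.
  apply: (@in_gp_sum _ _ _ (a *: q) (a *: p)).
  + by exists q.
  + by exists p.
  + by move=> i; rewrite !mxE ler_pM2l.
  + by move=> i; rewrite !mxE ler_pM2l.
Qed.

Lemma gp_sum_point t : gp_sum [set t] [set t] = [set t].
Proof.
apply/seteqP; split=> [x hx|_ ->]; last exact: (@in_gp_sum _ _ _ t t).
have [_ -> tx] := gp_sum_lower hx; have [_ -> xt] := gp_sum_upper hx.
by apply/rowP => i; apply/eqP; rewrite eq_le xt tx.
Qed.

End GPSum.

(** * Minkowski summands of GP-sums *)

Section SummandFaces.
Variables (R : realType) (n : nat) (Q P A B : set 'rV[R]_n).
Hypotheses (hQ : braid_polytope Q) (hP : braid_polytope P) (QP : dominated Q P).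
Hypotheses (pA : polytope A) (pB : polytope B) (XE : gp_sum Q P = msum A B).
Implicit Types (c : 'rV[R]_n) (s : 'S_n).

Lemma summand_top : msum (top_face A) (top_face B) = P.
Proof. by rewrite -(gp_sum_top hQ hP QP) XE !top_faceE face_msum. Qed.

Lemma summand_bottom : msum (bottom_face A) (bottom_face B) = Q.
Proof. by rewrite -(gp_sum_bottom hQ hP QP) XE !bottom_faceE face_msum. Qed.

Lemma summand_top_braid : braid_polytope (top_face A).
Proof.
apply: (@braid_polytope_summand _ _ _ (top_face B)); last by rewrite summand_top.
by rewrite top_faceE; exact: face_polytope.
Qed.

Lemma summand_bottom_braid : braid_polytope (bottom_face A).
Proof.
apply: (@braid_polytope_summand _ _ _ (bottom_face B)); last by rewrite summand_bottom.
by rewrite bottom_faceE; exact: face_polytope.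
Qed.

End SummandFaces.

Section SummandUpperBound.
Variables (R : realType) (n : nat) (Q P A B : set 'rV[R]_n).
Hypotheses (hQ : braid_polytope Q) (hP : braid_polytope P) (QP : dominated Q P).
Hypotheses (pA : polytope A) (pB : polytope B) (XE : gp_sum Q P = msum A B).
Implicit Types (c : 'rV[R]_n) (s : 'S_n).

Let XE' : gp_sum Q P = msum B A. Proof. by rewrite XE msumC. Qed.
Let htA := summand_top_braid hQ hP QP pA XE.
Let hbA := summand_bottom_braid hQ hP QP pA XE.
Let htB := summand_top_braid hQ hP QP pB XE'.
Let hbB := summand_bottom_braid hQ hP QP pB XE'.

Let topE s : perm_vertex P s = perm_vertex (top_face A) s + perm_vertex (top_face B) s.
Proof. by rewrite -perm_vertex_msum // (summand_top hQ hP QP XE). Qed.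

Let botE s :
  perm_vertex Q s = perm_vertex (bottom_face A) s + perm_vertex (bottom_face B) s.
Proof. by rewrite -perm_vertex_msum // (summand_bottom hQ hP QP XE). Qed.

(** Adding to a point of [A] the top or bottom vertex of [B] gives a point of
    [gp_sum Q P], whose support function is known. *)
Lemma summand_le s c y : braid_cone s c -> A y ->
  dotp y c <= gp_support (bottom_face A) (top_face A) s c.
Proof.
move=> hc Ay; rewrite {1}(pos_neg_part c) dotpDr lerD //.
- have hX : gp_sum Q P (y + perm_vertex (top_face B) s).
    rewrite XE; exists y => //; exists (perm_vertex (top_face B) s) => //.
    by have [] := perm_vertex_in s htB.
  by have := gp_sum_pos_part hP hc hX; rewrite topE !dotpDl lerD2r.
- have hX : gp_sum Q P (y + perm_vertex (bottom_face B) s).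
    rewrite XE; exists y => //; exists (perm_vertex (bottom_face B) s) => //.
    by have [] := perm_vertex_in s hbB.
  by have := gp_sum_neg_part hQ hc hX; rewrite botE !dotpDl lerD2r.
Qed.

End SummandUpperBound.

Section SummandSupport.
Variables (R : realType) (n : nat) (Q P A B : set 'rV[R]_n).
Hypotheses (hQ : braid_polytope Q) (hP : braid_polytope P) (QP : dominated Q P).
Hypotheses (pA : polytope A) (pB : polytope B) (XE : gp_sum Q P = msum A B).
Implicit Types (c : 'rV[R]_n) (s : 'S_n).

Let XE' : gp_sum Q P = msum B A. Proof. by rewrite XE msumC. Qed.
Let htA := summand_top_braid hQ hP QP pA XE.
Let hbA := summand_bottom_braid hQ hP QP pA XE.
Let htB := summand_top_braid hQ hP QP pB XE'.
Let hbB := summand_bottom_braid hQ hP QP pB XE'.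

(** The bounds of [summand_le] for [A] and [B] add up to the support function of
    [gp_sum Q P], which is attained; so both are attained. *)
Lemma summand_support s c : braid_cone s c ->
  exists2 a, A a & dotp a c = gp_support (bottom_face A) (top_face A) s c.
Proof.
move=> hc; have := gp_vertex_in (s, [set i | 0 < c 0 i]%SET) hQ hP QP.
rewrite XE => -[a Aa [b Bb abE]]; exists a => //.
have := gp_vertex_support Q P s c; rewrite -abE dotpDl /gp_support.
rewrite -(summand_top hQ hP QP XE) -(summand_bottom hQ hP QP XE).
rewrite !perm_vertex_msum // !dotpDl.
have := summand_le hQ hP QP pA pB XE hc Aa.
have := summand_le hQ hP QP pB pA XE' hc Bb.
rewrite /gp_support; lra.
Qed.

(** A point of [A] maximizing a functional [c] of the cone of [s] with
    [c 0 i = 0] has its [i]-th coordinate between those of the two vertices, as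
    seen by moving [c 0 i] slightly in both directions. *)
Lemma summand_dominated : dominated (bottom_face A) (top_face A).
Proof.
move=> s i; pose k := (s^-1)%g i.
(* Consecutive entries differ by one, which leaves room for changing the zero
   entry by one in either direction. *)
pose c : 'rV[R]_n := \row_j (((s^-1)%g j)%:R - k%:R).
have ci : c 0 i = 0 by rewrite mxE subrr.
have hc t : `|t| <= 1 -> braid_cone s (c + t *: delta_mx 0 i).
  move=> t1 l m; rewrite leq_eqVlt => /orP[/eqP/val_inj-> //|lm].
  rewrite !mxE !permK eqxx /=.
  have sE p : (s p == i) = (p == k) by rewrite /k -{1}(permKV s i) (inj_eq perm_inj).
  rewrite !sE; have : l.+1%:R <= m%:R :> R by rewrite ler_nat.
  rewrite -natr1; move: t1; rewrite ler_norml => /andP[].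
  case: (eqVneq l k) => lk; case: (eqVneq m k) => mk /=;
    rewrite ?mulr1n ?mulr0n; try lra.
have c0 : braid_cone s c.
  by rewrite -[c]addr0 -(scale0r (delta_mx 0 i)); apply: hc; rewrite normr0.
clearbody c; have [a Aa aE] := summand_support c0.
have ndE (j : 'I_n) : (delta_mx 0 i : 'rV[R]_n) 0 j = (j == i)%:R.
  by rewrite mxE eqxx.
have E1 : pos_part (c + 1 *: delta_mx 0 i) = pos_part c + delta_mx 0 i.
  apply/rowP => j; rewrite scale1r !(ndE, mxE); case: eqVneq => [->|_].
    by rewrite ci add0r maxxx add0r max_l.
  by rewrite !addr0.
have E2 : neg_part (c + 1 *: delta_mx 0 i) = neg_part c.
  apply/rowP => j; rewrite scale1r !(ndE, mxE); case: eqVneq => [->|_].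
    by rewrite ci add0r minxx min_r.
  by rewrite !addr0.
have E3 : pos_part (c + (-1) *: delta_mx 0 i) = pos_part c.
  apply/rowP => j; rewrite scaleN1r !(ndE, mxE); case: eqVneq => [->|_].
    by rewrite ci add0r maxxx max_r // lerN10.
  by rewrite subr0.
have E4 : neg_part (c + (-1) *: delta_mx 0 i) = neg_part c - delta_mx 0 i.
  apply/rowP => j; rewrite scaleN1r !(ndE, mxE); case: eqVneq => [->|_].
    by rewrite ci add0r minxx add0r min_l // lerN10.
  by rewrite !subr0.
have := summand_le hQ hP QP pA pB XE (hc 1 _) Aa.
have := summand_le hQ hP QP pA pB XE (hc (-1) _) Aa.
rewrite normrN normr1 lexx /gp_support E1 E2 E3 E4 => /(_ isT) h1 /(_ isT).
move: h1; rewrite /gp_support in aE.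
rewrite !(dotpDr, dotpZr, dotpNr) !dotp_delta aE; lra.
Qed.

Lemma summand_gp_sum : A = gp_sum (bottom_face A) (top_face A).
Proof.
have hd := summand_dominated; apply/seteqP; split.
- apply: sub_polytope; first exact: gp_sum_polytope.
  move=> c; have [s hs] := exists_braid_cone c.
  exists (gp_vertex (bottom_face A) (top_face A) (s, [set i | 0 < c 0 i]%SET)).
    exact: gp_vertex_in.
  by move=> y Ay; rewrite gp_vertex_support; exact: (summand_le hQ hP QP pA pB XE).
- apply: (sub_polytope pA) => c; have [s hs] := exists_braid_cone c.
  have [a Aa aE] := summand_support hs; exists a => // y hy.
  by rewrite aE; exact: gp_sum_le.
Qed.

End SummandSupport.

(** * The admissibility cone *)

Section AdmissibilityCone.
Variables (R : realType) (n : nat) (P Q : set 'rV[R]_n).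
Hypotheses (hP : braid_polytope P) (hQ : braid_polytope Q).
Implicit Types (A B X : set 'rV[R]_n) (t : 'rV[R]_n) (s : 'S_n).

Lemma admissible_summand A B X : admissibility_cone P Q X -> X = msum A B ->
  polytope A -> polytope B -> admissibility_cone P Q A.
Proof.
move=> [P' [Q' [dP dQ QP ->]]] XE pA pB.
have hP' := deformation_braid_polytope dP hP.
have hQ' := deformation_braid_polytope dQ hQ.
exists (top_face A), (bottom_face A); split.
- split; first by rewrite top_faceE; exact: face_polytope.
  have [_ [a [S [a0 pS E]]]] := dP; exists a, (msum (top_face B) S); split => //.
    by apply: msum_polytope => //; rewrite top_faceE; exact: face_polytope.
  by rewrite msumA (summand_top hQ' hP' QP XE).
- split; first by rewrite bottom_faceE; exact: face_polytope.
  have [_ [a [S [a0 pS E]]]] := dQ; exists a, (msum (bottom_face B) S); split => //.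
    by apply: msum_polytope => //; rewrite bottom_faceE; exact: face_polytope.
  by rewrite msumA (summand_bottom hQ' hP' QP XE).
- exact: summand_dominated XE.
- exact: summand_gp_sum XE.
Qed.

Lemma deformation_point t A : polytope A -> deformation [set t] A.
Proof.
move=> pA; split; first exact: point_polytope.
exists 1, (msum A [set - t]); split => //.
  by apply: msum_polytope => //; exact: point_polytope.
by rewrite msumC -msumA msum_point addNr msum0 dilate1.
Qed.

Lemma deformation_refl A : polytope A -> deformation A A.
Proof.
move=> pA; split=> //; exists 1, [set 0]; split => //; first exact: point_polytope.
by rewrite msum0 dilate1.
Qed.

Lemma deformation_dilate_translate a t A B : 0 < a -> deformation A B ->
  deformation (msum (dilate a A) [set t]) B.
Proof.
move=> a0 [pA [b [S [b0 pS E]]]]; split.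
  by apply: msum_polytope; [exact: dilate_polytope|exact: point_polytope].
exists (a * b), (msum [set - t] (dilate a S)); split; first exact: mulr_gt0.
  by apply: msum_polytope; [exact: point_polytope|exact: dilate_polytope].
by rewrite -msumA (msumA [set t]) msum_point subrr (msumC [set 0]) msum0 -dilate_msum
  E dilateA.
Qed.

Lemma admissible_translated_dilate A X : admissibility_cone P Q X ->
  translated_dilate A X -> admissibility_cone P Q A.
Proof.
move=> [P' [Q' [dP dQ QP ->]]] [a [t [a0 ->]]].
have hP' := deformation_braid_polytope dP hP.
have hQ' := deformation_braid_polytope dQ hQ.
(* For [a = 0] only the point [t] is left, the GP-sum of itself with itself. *)
move: a0; rewrite le_eqVlt => /orP[/eqP<-|a0].
  rewrite dilate0 ?msum_point ?add0r; last first.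
    by exists (gp_vertex Q' P' (1%g, finset.set0)); exact: gp_vertex_in.
  exists [set t], [set t]; split; last by rewrite gp_sum_point.
  - by apply: deformation_point; case: hP.
  - by apply: deformation_point; case: hQ.
  - by move=> s i.
exists (msum (dilate a P') [set t]), (msum (dilate a Q') [set t]); split.
- exact: deformation_dilate_translate.
- exact: deformation_dilate_translate.
- move=> s i; rewrite !perm_vertex_msum ?perm_vertex_dilate ?(ltW a0) //;
    try exact: braid_polytope_point; try exact: (braid_polytope_dilate (ltW a0)).
  by rewrite !mxE lerD2r ler_pM2l.
- by rewrite gp_sum_translate gp_sum_dilate.
Qed.

(** On an admissible [gp_sum Q' P'] these are the slacks of the inequalities
    defining [dominated Q' P'], expressed through the polytope itself. *)
Definition slack X s i :=
  perm_vertex (top_face X) s 0 i - perm_vertex (bottom_face X) s 0 i.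

Lemma admissible_faces X : admissibility_cone P Q X ->
  [/\ braid_polytope (top_face X), braid_polytope (bottom_face X),
      dominated (bottom_face X) (top_face X) & X !=set0].
Proof.
move=> [P' [Q' [dP dQ QP ->]]].
have hP' := deformation_braid_polytope dP hP.
have hQ' := deformation_braid_polytope dQ hQ.
rewrite gp_sum_top // gp_sum_bottom //; split => //.
by exists (gp_vertex Q' P' (1%g, finset.set0)); exact: gp_vertex_in.
Qed.

Lemma slack_ge0 X s i : admissibility_cone P Q X -> 0 <= slack X s i.
Proof. by move=> /admissible_faces[_ _ h _]; rewrite subr_ge0. Qed.

Lemma slack_msum A B s i : admissibility_cone P Q A -> admissibility_cone P Q B ->
  slack (msum A B) s i = slack A s i + slack B s i.
Proof.
move=> /admissible_faces[tA bA _ _] /admissible_faces[tB bB _ _]; rewrite /slack.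
have -> : top_face (msum A B) = msum (top_face A) (top_face B).
  by rewrite !top_faceE face_msum.
have -> : bottom_face (msum A B) = msum (bottom_face A) (bottom_face B).
  by rewrite !bottom_faceE face_msum.
rewrite !perm_vertex_msum // !mxE; ring.
Qed.

Lemma slack_dilate a A s i : 0 <= a -> admissibility_cone P Q A ->
  slack (dilate a A) s i = a * slack A s i.
Proof.
move=> a0 /admissible_faces[tA bA _ A0]; rewrite /slack.
move: (a0); rewrite le_eqVlt => /orP[/eqP<-|ap].
  rewrite dilate0 // top_faceE bottom_faceE !face_point !perm_vertex_point.
  by rewrite subrr mul0r.
have -> : top_face (dilate a A) = dilate a (top_face A).
  by rewrite !top_faceE face_dilate.
have -> : bottom_face (dilate a A) = dilate a (bottom_face A).
  by rewrite !bottom_faceE face_dilate.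
rewrite !perm_vertex_dilate // !mxE; ring.
Qed.

Lemma deformation_indecomposable A B : indecomposable B -> deformation A B ->
  translated_dilate A B.
Proof.
move=> [_ iB] [pA [a [S [a0 pS E]]]].
have aV : a * a^-1 = 1 by rewrite divff // gt_eqF.
have [|||[b [t [b0 AE]]] _] := iB (dilate a^-1 A) (dilate a^-1 S).
- exact: dilate_polytope.
- exact: dilate_polytope.
- by rewrite -dilate_msum E dilateA mulrC aV dilate1.
exists (a * b), (a *: t); split; first by rewrite mulr_ge0 // ltW.
by rewrite -dilateA -dilate_point -dilate_msum -AE dilateA aV dilate1.
Qed.

End AdmissibilityCone.

(** * Rays from seeds *)

Section Seeds.
Variables (R : realType) (n : nat) (P Q : set 'rV[R]_n) (lam mu : R).
Implicit Types (A B : set 'rV[R]_n) (s : 'S_n) (i : 'I_n).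

Local Notation X := (seed_polytope P Q lam mu).
Local Notation C := (admissibility_cone P Q).
Local Notation tight := (phi_minimizer P Q lam mu).

Lemma phi_le s i : phi P Q lam mu 0 i <= phi_diff P Q lam mu i s.
Proof. by rewrite mxE; exact: bigmin_le. Qed.

Lemma phiE s i : tight i s -> phi P Q lam mu 0 i = phi_diff P Q lam mu i s.
Proof.
move=> sm; apply/eqP; rewrite eq_le phi_le mxE /=.
by apply: le_bigmin => // *; exact: sm.
Qed.

Lemma exists_phi_minimizer i : exists s, tight i s.
Proof.
have [s sm] := arg_maxR 1%g (fun s => - phi_diff P Q lam mu i s).
by exists s => s'; have := sm s'; rewrite lerN2.
Qed.

(** A linear functional supporting the admissibility cone at the seed polytope:
    the sum of all the inequalities of the cone that are equalities there. *)
Definition tight_slack A := \sum_i \sum_(s | `[< tight i s >]) slack A s i.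

Hypotheses (bP : braid_polytope P) (bQ : braid_polytope Q).
Hypotheses (hlam : 0 < lam) (hmu : 0 < mu).

Local Notation P' := (dilate lam P).
Local Notation Q' := (msum (dilate mu Q) [set phi P Q lam mu]).

Let bP' : braid_polytope P'.
Proof. by apply: braid_polytope_dilate => //; exact: ltW. Qed.

Let bQ' : braid_polytope Q'.
Proof.
apply: braid_polytope_msum; last exact: braid_polytope_point.
by apply: braid_polytope_dilate => //; exact: ltW.
Qed.

Let P'E s i : perm_vertex P' s 0 i = lam * perm_vertex P s 0 i.
Proof. by rewrite perm_vertex_dilate ?mxE // ltW. Qed.

Let Q'E s i : perm_vertex Q' s 0 i = mu * perm_vertex Q s 0 i + phi P Q lam mu 0 i.
Proof.
rewrite perm_vertex_msum; last 2 first.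
- by apply: braid_polytope_dilate => //; exact: ltW.
- exact: braid_polytope_point.
by rewrite perm_vertex_dilate ?perm_vertex_point // ?ltW // !mxE.
Qed.

Lemma seed_dominated : dominated Q' P'.
Proof.
by move=> s i; rewrite P'E Q'E; have := phi_le s i; rewrite /phi_diff; lra.
Qed.

Lemma seed_top : top_face X = P'.
Proof. exact: gp_sum_top bQ' bP' seed_dominated. Qed.

Lemma seed_bottom : bottom_face X = Q'.
Proof. exact: gp_sum_bottom bQ' bP' seed_dominated. Qed.

Lemma seed_polytopeP : polytope X.
Proof. exact: gp_sum_polytope bQ' bP' seed_dominated. Qed.

Lemma seed_admissible : C X.
Proof.
exists P', Q'; split=> //; last exact: seed_dominated.
- rewrite -[P']msum0; apply: deformation_dilate_translate => //.
  by apply: deformation_refl; case: bP.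
- apply: deformation_dilate_translate => //.
  by apply: deformation_refl; case: bQ.
Qed.

Lemma seed_slack s i : slack X s i = phi_diff P Q lam mu i s - phi P Q lam mu 0 i.
Proof. by rewrite /slack seed_top seed_bottom P'E Q'E /phi_diff; ring. Qed.

Lemma tight_slack_msum A B : C A -> C B ->
  tight_slack (msum A B) = tight_slack A + tight_slack B.
Proof.
move=> CA CB; rewrite /tight_slack -big_split; apply: eq_bigr => i _.
by rewrite -big_split; apply: eq_bigr => s _; rewrite (slack_msum bP bQ).
Qed.

Lemma tight_slack_dilate a A : 0 <= a -> C A ->
  tight_slack (dilate a A) = a * tight_slack A.
Proof.
move=> a0 CA; rewrite /tight_slack mulr_sumr; apply: eq_bigr => i _.
by rewrite mulr_sumr; apply: eq_bigr => s _; rewrite (slack_dilate bP bQ).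
Qed.

Lemma tight_slack_ge0 A : C A -> 0 <= tight_slack A.
Proof.
by move=> CA; apply: sumr_ge0 => i _; apply: sumr_ge0 => s _; exact: (slack_ge0 bP bQ).
Qed.

Lemma tight_slack_eq0 A i s : C A -> tight_slack A = 0 -> tight i s ->
  slack A s i = 0.
Proof.
move=> CA + si; have ge0 i' s' : 0 <= slack A s' i' by exact: (slack_ge0 bP bQ).
move/eqP; rewrite psumr_eq0 => [/allP/(_ i (mem_index_enum _))/=|i' _]; last exact: sumr_ge0.
rewrite psumr_eq0 // => /allP/(_ s (mem_index_enum _))/=.
by move/asboolP: si => -> /eqP.
Qed.

Lemma tight_slack_seed : tight_slack X = 0.
Proof.
rewrite /tight_slack big1 // => i _; rewrite big1 // => s /asboolP si.
by rewrite seed_slack (phiE si) subrr.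
Qed.

Lemma tight_slack_point t : tight_slack [set t] = 0.
Proof.
rewrite /tight_slack big1 // => i _; rewrite big1 // => s _.
by rewrite /slack top_faceE bottom_faceE !face_point perm_vertex_point subrr.
Qed.

Hypotheses (iP : indecomposable P) (iQ : indecomposable Q).
Hypothesis hseed : seed P Q lam mu.

(** Since [P] and [Q] are indecomposable, [A] is given by two scalars [a] and [b]
    and two translations [x] and [y].  The two equations at the coordinate [j] of
    the seed say that [(a, b)] and [(lam, mu)] lie on the same line; the
    remaining equations then determine [y - x]. *)
Lemma tight_translated_dilate A : C A -> tight_slack A = 0 ->
  translated_dilate A X.
Proof.
move=> CA lA; have A0 i s := tight_slack_eq0 CA lA (i := i) (s := s).
have [_ _ [j [t [t' [tm tm' tt']]]]] := hseed.
have [P1 [Q1 [dP1 dQ1 QP1 AE]]] := CA.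
have [a [x [a0 P1E]]] := deformation_indecomposable iP dP1.
have [b [y [b0 Q1E]]] := deformation_indecomposable iQ dQ1.
have bP1 := deformation_braid_polytope dP1 bP.
have bQ1 := deformation_braid_polytope dQ1 bQ.
have slackA s i : slack A s i =
    a * perm_vertex P s 0 i + x 0 i - (b * perm_vertex Q s 0 i + y 0 i).
  rewrite /slack AE gp_sum_top // gp_sum_bottom // P1E Q1E.
  rewrite !perm_vertex_msum ?perm_vertex_dilate ?perm_vertex_point //;
    try exact: braid_polytope_point; try exact: braid_polytope_dilate.
  by rewrite !mxE.
pose dp := perm_vertex P t 0 j - perm_vertex P t' 0 j.
pose dq := perm_vertex Q t 0 j - perm_vertex Q t' 0 j.
have E1 : lam * dp = mu * dq.
  by have := phiE tm; rewrite (phiE tm') /phi_diff /dp /dq; lra.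
have E2 : a * dp = b * dq.
  by have := A0 _ _ tm; have := A0 _ _ tm'; rewrite !slackA /dp /dq; lra.
have dq0 : dq != 0.
  apply: contra_not_neq tt' => dq0.
  have dp0 : dp = 0.
    by move/eqP: E1; rewrite dq0 mulr0 mulf_eq0 gt_eqF //= => /eqP.
  by move/subr0_eq: dp0 => ->; move/subr0_eq: dq0 => ->.
pose k := a / lam.
have k0 : 0 <= k by rewrite divr_ge0 // ltW.
have ak : a = k * lam by rewrite divfK // gt_eqF.
have bk : b = k * mu by apply: (mulIf dq0); rewrite -E2 ak -!mulrA E1.
have yk : y = k *: phi P Q lam mu + x.
  apply/rowP => i; have [s sm] := exists_phi_minimizer i.
  have := A0 _ _ sm; rewrite slackA ak bk => h.
  by rewrite [RHS]mxE [X in _ = X + _]mxE (phiE sm) /phi_diff; lra.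
have PA : P1 = msum (dilate k P') [set x] by rewrite P1E ak dilateA.
have QA : Q1 = msum (dilate k Q') [set x].
  by rewrite Q1E bk yk dilate_msum dilate_point dilateA -msumA msum_point.
exists k, x; split=> //; rewrite AE PA QA gp_sum_translate.
move: k0; rewrite le_eqVlt => /orP[/eqP<-|k0]; last by rewrite gp_sum_dilate.
rewrite !dilate0 ?gp_sum_point //.
- by case: (admissible_faces bP bQ seed_admissible).
- by exists (perm_vertex P' 1%g); exact: perm_vertex_in.
- by exists (perm_vertex Q' 1%g); exact: perm_vertex_in.
Qed.

Lemma seed_cone_face : cone_face C [set A | translated_dilate A X].
Proof.
exists tight_slack; split; [exact: tight_slack_msum|exact: tight_slack_dilate|
  exact: tight_slack_ge0|].
have CX := seed_admissible; have tC := admissible_translated_dilate bP bQ CX.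
apply/seteqP; split => A /=; last by move=> [CA lA]; exact: tight_translated_dilate.
move=> hA; split; first exact: tC.
have [a [x [a0 ->]]] := hA.
have Cx : C [set x].
  apply: tC; exists 0, x; split => //.
  by rewrite dilate0 ?msum_point ?add0r //; case: (admissible_faces bP bQ CX).
have CaX : C (dilate a X) by apply: tC; exists a, 0; rewrite msum0.
rewrite tight_slack_msum // tight_slack_point tight_slack_dilate //.
by rewrite tight_slack_seed mulr0 addr0.
Qed.

(** The summands of the seed polytope are admissible, so the supporting functional
    is nonnegative on them; as it adds up to [0], it vanishes on both. *)
Lemma seed_indecomposable : indecomposable X.
Proof.
split; first exact: seed_polytopeP.
move=> A B pA pB E; have CX := seed_admissible.
have CA := admissible_summand bP bQ CX E pA pB.
have CB : C B by apply: (admissible_summand bP bQ CX _ pB pA); rewrite msumC.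
have := tight_slack_ge0 CA; have := tight_slack_ge0 CB.
have := tight_slack_seed; rewrite E tight_slack_msum // => ? ? ?.
by rewrite -E; split; apply: tight_translated_dilate => //; lra.
Qed.

End Seeds.

Theorem proposition3p8 (R : realType) (n : nat) (P Q : set 'rV[R]_n)
  (hP : deformed_permutahedron P) (hQ : deformed_permutahedron Q)
  (iP : indecomposable P) (iQ : indecomposable Q)
  (nP : ~ is_point P) (nQ : ~ is_point Q)
  (lam mu : R) (hlam : 0 < lam) (hmu : 0 < mu)
  (hseed : seed P Q lam mu) :
  [/\ cone_ray (admissibility_cone P Q) (seed_polytope P Q lam mu),
      normally_equivalent (top_face (seed_polytope P Q lam mu)) P,
      normally_equivalent (bottom_face (seed_polytope P Q lam mu)) Q
    & indecomposable (seed_polytope P Q lam mu)].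
Proof.
have bP := deformed_braid_polytope hP; have bQ := deformed_braid_polytope hQ.
have topX := seed_top bP bQ hlam hmu.
split; last exact: seed_indecomposable.
- split; [exact: seed_admissible| |exact: seed_cone_face].
  move=> [x Xx]; apply: nP; exists (lam^-1 *: x).
  move: topX; rewrite Xx top_faceE face_point => xE.
  by rewrite -dilate_point xE dilateA mulVf ?dilate1 // gt_eqF.
- by rewrite topX /normally_equivalent normal_fan_dilate.
- by rewrite seed_bottom // /normally_equivalent normal_fan_translate normal_fan_dilate.
Qed.
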